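(* Let $(\mathcal{X},\mathcal{P})$ be a good continuous latent variable model with dimension parameter $N$. Suppose that $\mathcal{P}$ satisfies Assumptions C1 and C2 and $\mathcal{X}$ satisfies Assumptions P1 and P2 (all defined in the context, with constants $A,B_2,B_4,B_6>0$). Then there is a constant $C_1>0$ depending only on the channel $\mathcal{P}$ and the constants $(A,B_2,B_4,B_6)$ such that, for all even $D\ge0$, $$\mathsf{CAdv}_{\le D}(\mathcal{X},\mathcal{P})^2\le C_1\,\mathsf{Univ}_{\le D}(\mathcal{X},1/F_{\mathcal{P}}).$$ Suppose further that $\mathcal{X}$ satisfies Assumption P3 (with constants $B_8,B_{10},B_{12}>0$). Then there are also constants $C_2,C_3>0$ depending only on the channel $\mathcal{P}$ and on the constants $(A,B_2,B_4,B_6,B_8,B_{10},B_{12})$ such that, for all even $D\ge0$, $$\mathsf{CAdv}_{\le D}(\mathcal{X},\mathcal{P})^2\ge C_2\,\mathsf{Univ}_{\le D}(\mathcal{X},1/F_{\mathcal{P}})-C_3\,\mathsf{Univ}_{\le D-2}(\mathcal{X},1/F_{\mathcal{P}}).$$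
   Context: $[N]=\{1,\dots,N\}$; $\exp^{\le D}(t)=\sum_{d=0}^D t^d/d!$ (empty sum, i.e. $0$, for $D<0$). A continuous latent variable model (CLVM) $(\mathcal{X},\mathcal{P})$ consists of: a set $\Sigma\subseteq\mathbb{R}$ containing $0$; an integer $N\ge1$; a probability measure $\mathcal{X}$ on $\Sigma^N$ (the prior); and, for each $x\in\Sigma$, a probability measure $\mathcal{P}_x$ on a measurable space $\Omega$ (the channel $\mathcal{P}=(\mathcal{P}_x)_{x\in\Sigma}$, depending measurably on $x$). It defines two probability measures on $\Omega^N$: under $\mathbb{Q}$, the $y_i$ are i.i.d. with law $\mathcal{P}_0$; under $\mathbb{P}$, one first draws $x\sim\mathcal{X}$ and then draws $y_i\sim\mathcal{P}_{x_i}$ independently for $i\in[N]$. It is good if $\Sigma$ contains an open interval around zero and, for all $x\in\Sigma$, $\mathcal{P}_x\ll\mathcal{P}_0$ with $d\mathcal{P}_x/d\mathcal{P}_0\in L^2(\mathcal{P}_0)$. Channel overlap: $R_{\mathcal{P}}(x^{(1)},x^{(2)})=\mathbb{E}_{y\sim\mathcal{P}_0}\left[\left(\frac{d\mathcal{P}_{x^{(1)}}}{d\mathcal{P}_0}(y)-1\right)\left(\frac{d\mathcal{P}_{x^{(2)}}}{d\mathcal{P}_0}(y)-1\right)\right]$ for $x^{(1)},x^{(2)}\in\Sigma$. Coordinate advantage: for $T\subseteq[N]$, $V_T\subseteq L^2(\mathbb{Q})$ is the subspace of functions depending only on $y_T=(y_i)_{i\in T}$, $V_{\le D}=\sum_{|T|\le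 D}V_T$, and $\mathsf{CAdv}_{\le D}(\mathcal{X},\mathcal{P})=\max\{\mathbb{E}_{y\sim\mathbb{P}}f(y): f\in V_{\le D},\ \mathbb{E}_{y\sim\mathbb{Q}}f(y)^2\le1\}$. Assumptions on the prior, for $x\sim\mathcal{X}$ (almost surely): P1. $\|x\|_\infty\le A$. P2. For each $k\in\{2,4,6\}$, $\|x\|_k\le B_kN^{\frac1k-\frac14}$. P3. For each $k\in\{8,10,12\}$, $\|x\|_k\le B_kN^{\frac1k-\frac14}$. Assumptions on the channel (with the same constant $A$): C1. $R_{\mathcal{P}}$ is $C^4$ in an open set containing $[-A,A]^2$. C2. $\frac{\partial^3R_{\mathcal{P}}}{\partial (x^{(1)})^2\,\partial x^{(2)}}(0,0)=0$. Fisher information: $F_{\mathcal{P}}=\frac{\partial^2R_{\mathcal{P}}}{\partial x^{(1)}\partial x^{(2)}}(0,0)$. For $\sigma^2>0$, $\mathsf{Univ}_{\le D}(\mathcal{X},\sigma^2)=\mathbb{E}_{x^{(1)},x^{(2)}\sim\mathcal{X}}\exp^{\le D}\left(\frac1{\sigma^2}\langle x^{(1)},x^{(2)}\rangle\right)$ with $x^{(1)},x^{(2)}$ independent; thus $\mathsf{Univ}_{\le D}(\mathcal{X},1/F_{\mathcal{P}})=\mathbb{E}\exp^{\le D}(F_{\mathcal{P}}\langle x^{(1)},x^{(2)}\rangle)$. *)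

(* Defs.v *)
From HB Require Import structures.
From mathcomp Require Import all_boot all_order all_algebra.
From mathcomp Require Import all_classical all_reals all_analysis.
From mathcomp Require Import measurable_realfun giry.
Set Implicit Arguments.
Unset Strict Implicit.
Unset Printing Implicit Defensive.
Import Order.TTheory GRing.Theory Num.Theory.
Import numFieldNormedType.Exports.
Local Open Scope classical_set_scope.
Local Open Scope charge_scope.
Local Open Scope ring_scope.

Record alphabet (R : realType) := Alphabet {
  alphabet_set :> set R ;
  alphabet0 : alphabet_set 0 }.

(* No measurability of the alphabet is assumed: its elements carry the trace
   of the Borel sigma-algebra. *)
Definition letter (R : realType) (S : alphabet R) : Type := set_type S.

Section letter.
Context {R : realType} (S : alphabet R).

HB.instance Definition _ := SubChoice.on (letter S).

Definition letter0 : letter S := SigSub (mem_set (alphabet0 S)).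

HB.instance Definition _ := isPointed.Build (letter S) letter0.

Definition letter_val (a : letter S) : R := val a.

HB.instance Definition _ := Measurable.copy (letter S)
  (g_sigma_algebra_preimageType letter_val).

(* equal to [letter0] outside of the alphabet *)
Definition to_letter (r : R) : letter S := insubd letter0 r.

End letter.
Coercion letter_val : letter >-> Real.sort.

Section kernel_law.
Context d1 d2 (T1 : measurableType d1) (T2 : measurableType d2) (R : realType).
Variables (k : R.-pker T1 ~> T2) (x : T1).

Definition klaw : set T2 -> \bar R := k x.

HB.instance Definition _ := Measure.on klaw.

Let klaw_setT : klaw [set: T2] = 1%E.
Proof. exact: prob_kernel. Qed.

HB.instance Definition _ := Measure_isProbability.Build _ _ _ klaw klaw_setT.

Definition law : probability T2 R := klaw.

End kernel_law.

Section independent_tuple.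
Context d (T : measurableType d) (R : realType).

Section step.
Variables (n : nat) (p : probability T R) (q : probability (n.-tuple T) R).

Definition tuple_cons (z : T * n.-tuple T) : n.+1.-tuple T := [tuple of z.1 :: z.2].

Let measurable_tuple_cons : measurable_fun [set: T * n.-tuple T] tuple_cons.
Proof. by apply: measurable_cons => /=. Qed.

Definition cons_law : set (n.+1.-tuple T) -> \bar R :=
  pushforward (p \x q)%E tuple_cons.

Let cons_law0 : cons_law set0 = 0%E.
Proof. by rewrite /cons_law /pushforward preimage_set0 measure0. Qed.

Let cons_law_ge0 A : (0 <= cons_law A)%E.
Proof. exact: measure_ge0. Qed.

Let cons_law_sigma_additive : semi_sigma_additive cons_law.
Proof.
exact: (@measure_semi_sigma_additive _ _ _
  (pushforward (p \x q)%E tuple_cons : {measure set _ -> \bar R})).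
Qed.

HB.instance Definition _ := isMeasure.Build _ _ _ cons_law
  cons_law0 cons_law_ge0 cons_law_sigma_additive.

Let cons_law_setT : cons_law setT = 1%E.
Proof.
rewrite /cons_law /pushforward preimage_setT -setXTT product_measure1E//.
by rewrite -[RHS]mule1; congr (_ * _)%E; exact: probability_setT.
Qed.

HB.instance Definition _ :=
  Measure_isProbability.Build _ _ _ cons_law cons_law_setT.

Definition tuple_cons_law : probability (n.+1.-tuple T) R := cons_law.

End step.

Definition nil_law : set (0.-tuple T) -> \bar R := \d_[tuple].

HB.instance Definition _ := Measure.on nil_law.

Let nil_law_setT : nil_law setT = 1%E.
Proof. by rewrite /nil_law diracT. Qed.

HB.instance Definition _ := Measure_isProbability.Build _ _ _ nil_law nil_law_setT.

Fixpoint tuple_law (n : nat) : ('I_n -> probability T R) ->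
    probability (n.-tuple T) R :=
  if n is m.+1 then
    fun p => tuple_cons_law (p ord0) (tuple_law (fun i => p (lift ord0 i)))
  else fun=> nil_law.

End independent_tuple.

Section measurable_tuple_law.
Context d1 d2 (T1 : measurableType d1) (T2 : measurableType d2) (R : realType).
Variable k : R.-pker T1 ~> T2.

Lemma measurable_tuple_law n (A : set (n.-tuple T2)) : measurable A ->
  measurable_fun [set: n.-tuple T1]
    (fun x => tuple_law (fun i => law k (tnth x i)) A : \bar R).
Proof.
elim: n A => [|n IHn] A mA; first exact: measurable_cst.
pose f (z : T2 * n.-tuple T2) : n.+1.-tuple T2 := [tuple of z.1 :: z.2].
have mf : measurable_fun [set: T2 * n.-tuple T2] f by exact: measurable_cons.
have mfA : measurable (f @^-1` A) by rewrite -[X in measurable X]setTI; exact: mf.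
pose g1 (x : n.+1.-tuple T1) : giry T2 R := law k (thead x).
pose g2 (x : n.+1.-tuple T1) : giry (n.-tuple T2) R :=
  tuple_law (fun i => law k (tnth [tuple of behead x] i)).
have mg1 : measurable_fun [set: n.+1.-tuple T1] g1.
  apply: measurable_giry_codensity => // B mB.
  apply: (measurableT_comp (measurable_kernel k B mB)).
  exact: measurable_tnth.
have mg2 : measurable_fun [set: n.+1.-tuple T1] g2.
  apply: measurable_giry_codensity => // B mB.
  exact: (measurableT_comp (IHn B mB) (@measurable_behead _ _ _)).
have mg := measurableT_comp measurable_giry_prod (measurable_fun_pair mg1 mg2).
have := measurableT_comp (measurable_giry_ev mfA) mg.
apply: eq_measurable_fun => x _.
have E : tuple_law (fun i => law k (tnth [tuple of behead x] i)) =
         tuple_law (fun i => law k (tnth x (lift ord0 i))).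
  by congr tuple_law; apply/funext => i; rewrite [in RHS](tuple_eta x) tnthS.
exact: (congr1 (fun q : probability (n.-tuple T2) R =>
  (law k (thead x) \x q)%E (f @^-1` A)) E).
Qed.

End measurable_tuple_law.

Section mixture.
Context d1 d2 (T1 : measurableType d1) (T2 : measurableType d2) (R : realType).
Variables (mu : probability T1 R) (k : T1 -> probability T2 R).

Definition mixture_measure
    (mk : forall A, measurable A ->
       measurable_fun [set: T1] (fun x => k x A : \bar R))
    (A : set T2) : \bar R :=
  (\int[mu]_x k x A)%E.

Hypothesis mk : forall A, measurable A ->
  measurable_fun [set: T1] (fun x => k x A : \bar R).

Local Notation mix := (mixture_measure mk).

Let mix0 : mix set0 = 0%E.
Proof. by rewrite /mixture_measure integral0_eq. Qed.

Let mix_ge0 A : (0 <= mix A)%E.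
Proof. exact: integral_ge0. Qed.

Let mix_sigma_additive : semi_sigma_additive mix.
Proof.
move=> F mF tF mUF; rewrite [X in _ --> X](_ : _ =
  (\int[mu]_x (\sum_(n <oo) k x (F n)))%E); last first.
  apply: eq_integral => x _.
  by apply/esym/cvg_lim => //; exact: measure_semi_sigma_additive.
apply/cvg_closeP; split.
  by apply: is_cvg_nneseries => n _ _; exact: mix_ge0.
rewrite closeE// integral_nneseries// => n.
exact: mk.
Qed.

HB.instance Definition _ := isMeasure.Build _ _ _ mix
  mix0 mix_ge0 mix_sigma_additive.

Let mix_setT : mix setT = 1%E.
Proof.
transitivity (\int[mu]__ 1)%E; first by apply: eq_integral => x _; exact: probability_setT.
by rewrite integral_cst// mul1e; exact: probability_setT.
Qed.

HB.instance Definition _ := Measure_isProbability.Build _ _ _ mix mix_setT.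

Definition mixture : probability T2 R := mix.

End mixture.

Section class_C.
Context {R : realType}.

Definition partial1 (f : R * R -> R) : R * R -> R := 'D_(1 : R, 0 : R) f.

Definition partial2 (f : R * R -> R) : R * R -> R := 'D_(0 : R, 1 : R) f.

Fixpoint class_C (k : nat) (U : set (R * R)) (f : R * R -> R) : Prop :=
  (forall z, U z -> {for z, continuous f}) /\
  if k is k'.+1 then
    [/\ forall z, U z -> derivable f z (1 : R, 0 : R) /\
                         derivable f z (0 : R, 1 : R),
        class_C k' U (partial1 f) & class_C k' U (partial2 f)]
  else True.

End class_C.

Section channel.
Context d (Omega : measurableType d) (R : realType) (S : alphabet R).
Variable P : R.-pker letter S ~> Omega.

Definition channel0 : probability Omega R := law P (letter0 S).

Definition likelihood_ratio (a : letter S) (y : Omega) : R :=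
  fine (('d (charge_of_finite_measure (law P a)) '/d channel0) y).

Definition good_channel :=
  (exists a b : R, [/\ a < 0, 0 < b & `]a, b[ `<=` S]) /\
  forall a : letter S,
    law P a `<< channel0 /\ likelihood_ratio a \in Lfun channel0 2%:E.

Definition overlap (a b : letter S) : R :=
  \int[channel0]_y ((likelihood_ratio a y - 1) * (likelihood_ratio b y - 1)).

(* Only the values on [S `*` S] are meaningful: partial derivatives of this
   function are taken at interior points of [S `*` S] only. *)
Definition overlapR (z : R * R) : R :=
  overlap (to_letter S z.1) (to_letter S z.2).

Definition assumption_C1 (A : R) :=
  exists U : set (R * R),
    [/\ open U, `[- A, A] `*` `[- A, A] `<=` U, U `<=` S `*` S &
        class_C 4 U overlapR].

Definition assumption_C2 :=
  partial1 (partial1 (partial2 overlapR)) (0, 0) = 0.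

Definition fisher_information : R := partial1 (partial2 overlapR) (0, 0).

End channel.

Section prior.
Context (R : realType) (S : alphabet R) (N : nat).
Variable X : probability (N.-tuple (letter S)) R.

Definition norm_infty (x : N.-tuple (letter S)) : R :=
  \big[Num.max/0]_(i < N) `|tnth x i : R|.

Definition norm_power (k : nat) (x : N.-tuple (letter S)) : R :=
  (\sum_(i < N) `|tnth x i : R| ^+ k) `^ k%:R^-1.

Definition inner (x x' : N.-tuple (letter S)) : R :=
  \sum_(i < N) (tnth x i : R) * (tnth x' i : R).

Definition assumption_P1 (A : R) := {ae X, forall x, norm_infty x <= A}.

Definition norm_power_bounded (k : nat) (B : R) :=
  {ae X, forall x, norm_power k x <= B * N%:R `^ (k%:R^-1 - 4^-1)}.

Definition assumption_P2 (B2 B4 B6 : R) :=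
  [/\ norm_power_bounded 2 B2, norm_power_bounded 4 B4 &
      norm_power_bounded 6 B6].

Definition assumption_P3 (B8 B10 B12 : R) :=
  [/\ norm_power_bounded 8 B8, norm_power_bounded 10 B10 &
      norm_power_bounded 12 B12].

Definition exp_trunc (D : int) (t : R) : R :=
  if D is Posz n then \sum_(d < n.+1) t ^+ d / d`!%:R else 0.

(* When [sigma2 = 0] this is the limit [sigma2 -> +oo], because [0^-1 = 0];
   with [sigma2 := F^-1] the integrand is [exp_trunc D (F * inner _ _)] for
   every [F], including [F = 0]. *)
Definition Univ (sigma2 : R) (D : int) : \bar R :=
  (\int[X \x X]_z (exp_trunc D (sigma2^-1 * inner z.1 z.2))%:E)%E.

End prior.

Section coordinate_advantage.
Context d (Omega : measurableType d) (R : realType) (S : alphabet R).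
Variables (P : R.-pker letter S ~> Omega) (N : nat).
Variable X : probability (N.-tuple (letter S)) R.

Definition null_law : probability (N.-tuple Omega) R :=
  tuple_law (fun=> channel0 P).

Definition planted_law : probability (N.-tuple Omega) R :=
  mixture X (@measurable_tuple_law _ _ _ _ _ P N).

Definition coordinate_space (T : {set 'I_N}) : set (N.-tuple Omega -> R) :=
  [set f | f \in Lfun null_law 2%:E /\
     forall y y', (forall i, i \in T -> tnth y i = tnth y' i) -> f y = f y'].

Definition coordinate_degree_space (D : nat) : set (N.-tuple Omega -> R) :=
  [set f | exists2 g : {set 'I_N} -> N.-tuple Omega -> R,
     forall T, coordinate_space T (g T) &
     forall y, f y = \sum_(T : {set 'I_N} | (#|T| <= D)%N) g T y].

(* Members are functions rather than classes modulo null sets of [null_law];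
   this does not affect the advantage, as [planted_law] is absolutely
   continuous with respect to [null_law] for a good channel. *)
Definition CAdv (D : nat) : \bar R :=
  ereal_sup [set ('E_planted_law[f])%E | f in
    [set f | coordinate_degree_space D f /\
             ('E_null_law[(fun y => f y ^+ 2)%R] <= 1)%E]].

End coordinate_advantage.

(* Main.v *)
Require Import Defs.
From HB Require Import structures.
From mathcomp Require Import all_boot all_order all_algebra.
From mathcomp Require Import all_classical all_reals all_analysis.
From mathcomp Require Import measurable_realfun giry.
From mathcomp Require Import ring lra zify.

(** Write [r_i = R(x_i, x'_i)] for the channel overlaps along two independent
    draws [x], [x'] of the prior, and [S_D(r)] for the sum over [|T| <= D] of the
    products of [r_i] over [i] in [T].

    The planted likelihood ratio given [x] is a product over the coordinates of
    [1 + (L_i - 1)]; its expansion is orthogonal, with the term of index [T]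
    depending on [y_T] only, so its projection on functions of coordinate degree
    at most [D] keeps the terms with [|T| <= D].  Averaging over the prior,
    [CAdv ^ 2] is the mean of [S_D(r)] over [x], [x'] ([CAdv_sqr]).  The ratio is
    measurable in the observation for each letter, but not assumed jointly
    measurable, so that its average over the prior is not a function of [y] that
    can be manipulated; it is replaced by averages over finite samples of the
    prior, chosen greedily ([exists_gram_sum_le]).

    It remains to compare [S_D(r)] with the truncated exponential at
    [t = F <x, x'>], for almost all [x], [x'].  As [R] is symmetric and vanishes on
    both axes, [R(a, b) = a b g(c, e)] for the mixed derivative [g] at some
    intermediate point, and the vanishing third derivative makes [g] flat at the
    origin: [R(a, b) = F a b + O(|a b| (a ^ 2 + b ^ 2))] ([bilinear_approx]).  With
    the bounds on the norms of [x] and [x'] of orders 2, 4 and 6, both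
    [sum r_i - t] and [sum r_i ^ 2] are bounded ([overlap_moments]).  Under these
    two bounds,
      [prod (1 + r_i X) = h(X) exp (t X)],
      [h(X) = exp ((sum r_i - t) X) prod (1 + r_i X) exp (- r_i X)],
    and the sum of the [|h_j| 13 ^ j] is bounded; moreover [S_D(r)] is the sum of the
    [h_j] times the exponential truncated at [D - j] ([elem_sum_expansion]).  For
    even [D] lowering the truncation order by [j] costs at most a factor [13 ^ j],
    uniformly in [t] ([texp_sub_le]).  Summing up gives the upper bound.  For the
    lower bound the term [j = 0] is the main one, the terms [j >= 2] are absorbed by
    the order [D - 2], and the odd term [j = 1] is interpolated between the orders
    [D] and [D - 2] ([texp_odd_le]). *)

Set Implicit Arguments.
Unset Strict Implicit.
Unset Printing Implicit Defensive.
Import Order.TTheory GRing.Theory Num.Theory.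
Import numFieldNormedType.Exports.
Local Open Scope classical_set_scope.
Local Open Scope ring_scope.

(** * Truncated exponentials *)
Section TruncatedExponential.
Context {R : realType}.
Implicit Types (t s : R) (n : nat).

(** The case of nonnegative order of [exp_trunc], with the order in [nat]. *)
Definition texp n t : R := \sum_(d < n.+1) t ^+ d / d`!%:R.

Lemma texp0 t : texp 0 t = 1.
Proof. by rewrite /texp big_ord1 expr0 fact0 divr1. Qed.

Lemma texpS n t : texp n.+1 t = texp n t + t ^+ n.+1 / n.+1`!%:R.
Proof. by rewrite /texp big_ord_recr. Qed.

Lemma texp_at0 n : texp n 0 = 1.
Proof.
by elim: n => [|n IH]; rewrite ?texp0// texpS IH expr0n mul0r addr0.
Qed.

Lemma texp_ge0 n t : 0 <= t -> 0 <= texp n t.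
Proof. by move=> t0; apply: sumr_ge0 => i _; rewrite divr_ge0 ?exprn_ge0. Qed.

Lemma is_derive_monomial n t :
  is_derive t 1 (fun u => u ^+ n.+1 / n.+1`!%:R) (t ^+ n / n`!%:R).
Proof.
have -> : (fun u : R => u ^+ n.+1 / n.+1`!%:R) =
          (n.+1`!%:R^-1 : R) *: (id ^+ n.+1 : R -> R).
  by apply/funext => u; rewrite /= mulrC exprfctE.
apply: is_derive_eq.
rewrite /GRing.scale /= mulr1 -mulr_natl factS natrM.
by field; rewrite nat1r !pnatr_eq0 -!lt0n fact_gt0.
Qed.

Lemma is_derive_texp n t : is_derive t 1 (texp n.+1) (texp n t).
Proof.
elim: n => [|n IH].
  have -> : texp 1 = (cst 1 + id) :> (R -> R).
    by apply/funext => u; rewrite texpS texp0 expr1 divr1.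
  by apply: is_derive_eq; rewrite texp0 add0r.
have -> : texp n.+2 = texp n.+1 + (fun u => u ^+ n.+2 / n.+2`!%:R).
  by apply/funext => u; rewrite texpS.
have D := is_derive_monomial n.+1 t.
by apply: is_derive_eq; rewrite texpS.
Qed.

Lemma derive_le0_noninc (f df : R -> R) (a b : R) :
  (forall x : R, is_derive x 1 f (df x)) -> a <= b ->
  (forall x, a <= x <= b -> df x <= 0) -> f b <= f a.
Proof.
move=> fdf ab df0.
have cf : {within `[a, b], continuous f}.
  apply: continuous_subspaceT => x.
  by apply/differentiable_continuous/derivable1_diffP; exact: ex_derive.
have [c cab fE] := MVT_segment ab (fun x _ => fdf x) cf.
rewrite -subr_le0 fE mulr_le0_ge0 ?subr_ge0 //; apply: df0.
by rewrite in_itv in cab.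
Qed.

Lemma is_derive_expRN t : is_derive t 1 (fun u => expR (- u)) (- expR (- t)).
Proof.
have -> : (fun u => expR (- u)) = expR \o -%R :> (R -> R) by [].
by apply: is_derive_eq; rewrite mulrN1.
Qed.

(** All the monomials but the last one cancel; every comparison of [texp] with
    [expR] rests on this. *)
Lemma is_derive_expR_texp n t :
  is_derive t 1 (fun u => expR (- u) * texp n.+1 u)
    (- (expR (- t) * (t ^+ n.+1 / n.+1`!%:R))).
Proof.
have D1 := is_derive_expRN t; have D2 := is_derive_texp n t.
have -> : (fun u => expR (- u) * texp n.+1 u) =
  (fun u => expR (- u)) * texp n.+1 :> (R -> R) by apply/funext.
apply: is_derive_eq; rewrite /GRing.scale /= texpS; ring.
Qed.

Lemma expR_le_texp n t : odd n -> t <= 0 -> expR t <= texp n.+1 t.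
Proof.
move=> on t0; rewrite -[leLHS]mul1r -ler_pdivlMr ?expR_gt0// -expRN mulrC.
have -> : 1 = expR (- 0) * texp n.+1 0 :> R by rewrite texp_at0 oppr0 expR0 mulr1.
apply: (derive_le0_noninc (is_derive_expR_texp n)) => // x _.
by rewrite oppr_le0 mulr_ge0 ?expR_ge0// divr_ge0// exprn_even_ge0//= on.
Qed.

Lemma expR_half_le2 : expR 2^-1 <= 2 :> R.
Proof.
have := expR_ge1Dx (- 2^-1 : R); rewrite expRN => h.
have e0 : 0 < expR 2^-1 :> R by exact: expR_gt0.
have : 2^-1 <= (expR 2^-1)^-1 :> R by apply: le_trans h; lra.
by rewrite lef_pV2 ?posrE.
Qed.

(** From [n ^ n / n! <= e ^ n] and [e ^ (9 / 8) <= 8]. *)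
Lemma expn_expR_le_fact n : (n%:R / 8) ^+ n * expR (n%:R / 8) <= n`!%:R :> R.
Proof.
case: n => [|n]; first by rewrite expr0 mul1r mul0r expR0.
set m := n.+1.
have fm : 0 < m`!%:R :> R by rewrite ltr0n fact_gt0.
have h1 : m%:R ^+ m <= expR 1 ^+ m * m`!%:R :> R.
  rewrite -ler_pdivrMr// -expRM_natl mulr1.
  by apply: le_trans (expR_ge1Dxn n (ler0n _ _)); rewrite lerDr.
have e2 := expR_half_le2; have e0 : 0 < expR 2^-1 :> R by exact: expR_gt0.
have e1 : expR 1 = expR 2^-1 * expR 2^-1 :> R.
  by rewrite -expRD; congr expR; lra.
have e8 : expR 8^-1 <= expR 2^-1 :> R by rewrite ler_expR; lra.
have -> : expR (m%:R / 8) = expR 8^-1 ^+ m :> R by rewrite -expRM_natl.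
have h2 : (expR 1 * expR 8^-1) / 8 <= 1 :> R.
  have : expR 1 * expR 8^-1 <= 2 * 2 * 2 :> R; last by lra.
  rewrite e1 !ler_pM ?mulr_ge0 ?expR_ge0//.
  exact: le_trans e2.
rewrite expr_div_n -mulrA.
apply: (le_trans (ler_wpM2r _ h1)).
  by rewrite mulr_ge0// ?invr_ge0 exprn_ge0// expR_ge0.
rewrite mulrAC -[leRHS]mul1r ler_wpM2r ?ler0n//.
rewrite mulrCA mulrC -exprMn -exprVn -exprMn.
by apply: exprn_ile1 => //; rewrite !mulr_ge0// expR_ge0.
Qed.

Lemma monomial_expR_le1 n t : t <= 0 -> - (n%:R / 8) <= t ->
  expR (- t) * `|t| ^+ n <= n`!%:R.
Proof.
move=> t0 tn; rewrite ler0_norm//; apply: le_trans (expn_expR_le_fact n).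
rewrite mulrC ler_pM ?expR_ge0 ?exprn_ge0 ?ler_expR; try lra.
by apply: lerXn2r; rewrite ?nnegrE; lra.
Qed.

(** For [t >= 0] all the terms are nonnegative.  For [t < 0] and [|t| <= n.+1 / 8]
    the monomial is below [expR t], hence below the truncation.  Beyond this
    threshold [expR (- t) * (texp n.+1 t - t ^+ n.+1 / n.+1`! / 9)] grows with
    [|t|], because the previous monomial is at most 8 times the last one. *)
Lemma last_monomial_le n t : odd n -> t ^+ n.+1 / n.+1`!%:R <= 9 * texp n.+1 t.
Proof.
move=> on.
have fn k : 0 < k`!%:R :> R by rewrite ltr0n fact_gt0.
have en : 0 <= t ^+ n.+1 by rewrite exprn_even_ge0//= on.
have [t0|t0] := leP 0 t.
  have := texp_ge0 n t0; have : 0 <= t ^+ n.+1 / n.+1`!%:R by rewrite divr_ge0.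
  by rewrite texpS; lra.
have en' : t ^+ n.+1 = `|t| ^+ n.+1 by rewrite -normrX ger0_norm.
have small s : s <= 0 -> - (n.+1%:R / 8) <= s ->
    s ^+ n.+1 / n.+1`!%:R <= texp n.+1 s.
  move=> s0 sn; apply: le_trans (expR_le_texp on s0).
  have es : s ^+ n.+1 = `|s| ^+ n.+1.
    by rewrite -normrX ger0_norm// exprn_even_ge0//= on.
  rewrite ler_pdivrMr// -[expR s]invrK -expRN mulrC ler_pdivlMr ?expR_gt0//.
  by rewrite es mulrC monomial_expR_le1.
have nn s : 0 <= s ^+ n.+1 / n.+1`!%:R.
  by rewrite divr_ge0// exprn_even_ge0//= on.
have [tn|tn] := leP (- (n.+1%:R / 8)) t.
  by have := small _ (ltW t0) tn; have := nn t; lra.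
pose c : R := 9^-1.
suff : 0 <= expR (- t) * (texp n.+1 t - c * (t ^+ n.+1 / n.+1`!%:R)).
  by rewrite pmulr_rge0 ?expR_gt0// /c; lra.
pose t1 : R := - (n.+1%:R / 8).
have t10 : t1 <= 0 by rewrite oppr_le0 divr_ge0.
apply: (@le_trans _ _
   (expR (- t1) * (texp n.+1 t1 - c * (t1 ^+ n.+1 / n.+1`!%:R)))).
  rewrite mulr_ge0 ?expR_ge0//.
  by have := small t1 t10 (lexx _); have := nn t1; rewrite /c; lra.
pose dw x := expR (- x) * ((c - 1) * (x ^+ n.+1 / n.+1`!%:R)
                - c * (x ^+ n / n`!%:R)).
have Dw (x : R) : is_derive x 1
  (fun u => expR (- u) * (texp n.+1 u - c * (u ^+ n.+1 / n.+1`!%:R))) (dw x).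
  have D1 := is_derive_expRN x; have D2 := is_derive_expR_texp n x.
  have D3 := is_derive_monomial n x.
  have -> : (fun u => expR (- u) * (texp n.+1 u - c * (u ^+ n.+1 / n.+1`!%:R))) =
    (fun u => expR (- u) * texp n.+1 u) -
      c *: ((fun u => expR (- u)) * (fun u => u ^+ n.+1 / n.+1`!%:R)) :> (R -> R).
    by apply/funext => u; rewrite !fctE /GRing.scale /=; ring.
  by apply: is_derive_eq; rewrite /dw /GRing.scale /=; ring.
apply: (derive_le0_noninc Dw (ltW tn)) => x /andP[_ xt1].
rewrite /dw pmulr_rle0 ?expR_gt0//.
have x0 : x < 0 by apply: le_lt_trans xt1 _; rewrite oppr_lt0 divr_gt0.
(* consecutive monomials have ratio at most 8 beyond the threshold *)
have : - (x ^+ n / n`!%:R) <= 8 * (x ^+ n.+1 / n.+1`!%:R).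
  rewrite factS natrM exprS.
  have -> : 8 * (x * x ^+ n / (n.+1%:R * n`!%:R)) =
      - (x ^+ n / n`!%:R) * (- x * 8 / n.+1%:R).
    by field; rewrite nat1r !pnatr_eq0 -!lt0n fact_gt0.
  rewrite ler_peMr//.
    by rewrite -mulNr divr_ge0// oppr_ge0 exprn_odd_le0// ltW.
  by rewrite ler_pdivlMr// mul1r; rewrite /t1 in xt1; lra.
by have := nn x; rewrite /c; lra.
Qed.

End TruncatedExponential.

Section TexpRatios.
Context {R : realType}.
Implicit Types (t : R) (n D : nat).

Lemma texp_even_ge0 D t : ~~ odd D -> 0 <= texp D t.
Proof.
case: D => [|n] on; first by rewrite texp0.
have {}on : odd n by rewrite /= negbK in on.
have := last_monomial_le t on.
have : 0 <= t ^+ n.+1 / n.+1`!%:R by rewrite divr_ge0// exprn_even_ge0//= on.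
lra.
Qed.

(** [texp n] is [texp n.+1] without its last monomial, which [last_monomial_le]
    controls. *)
Lemma texp_pred_le n t : odd n -> `|texp n t| <= 13 * texp n.+1 t.
Proof.
move=> on; have := last_monomial_le t on.
have := @texp_even_ge0 n.+1 t; rewrite /= on => /(_ isT).
have : 0 <= t ^+ n.+1 / n.+1`!%:R by rewrite divr_ge0// exprn_even_ge0//= on.
rewrite ler_norml texpS; lra.
Qed.

(** The constant is any square above [1 + 144], so that one step and two steps down
    cost powers of the same base. *)
Lemma texp_pred2_le n t : ~~ odd n -> texp n t <= 13 ^+ 2 * texp n.+2 t.
Proof.
move=> en; have on : odd n.+1 by [].
have en2 : ~~ odd n.+2 by rewrite /= negbK.
have h1 := texp_even_ge0 t en2.
have [t0|t0] := leP 0 t.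
  have := texp_ge0 n t0; rewrite 2!texpS.
  have p k : 0 <= t ^+ k / k`!%:R by rewrite divr_ge0 ?exprn_ge0.
  have := p n.+1; have := p n.+2; lra.
have h2 := last_monomial_le t on.
have nn2 : 0 <= t ^+ n.+2 / n.+2`!%:R by rewrite divr_ge0// exprn_even_ge0//= on.
suff h3 : - (t ^+ n.+1 / n.+1`!%:R) <= 144 * texp n.+2 t.
  by have := texpS n t; have := texpS n.+1 t; lra.
have [tn|tn] := leP (- (n.+1%:R / 8)) t.
  apply: (@le_trans _ _ (texp n.+2 t)); last by lra.
  apply: le_trans (expR_le_texp on (ltW t0)).
  rewrite -[expR t]invrK -expRN -[leRHS]mulr1 ler_pdivlMl ?expR_gt0//.
  have fn : 0 < n.+1`!%:R :> R by rewrite ltr0n fact_gt0.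
  rewrite -mulNr mulrA ler_pdivrMr// mul1r.
  apply: le_trans (monomial_expR_le1 (ltW t0) tn).
  by rewrite ler_wpM2l ?expR_ge0// -normrX ler_normr lexx orbT.
have : - (t ^+ n.+1 / n.+1`!%:R) <= 16 * (t ^+ n.+2 / n.+2`!%:R); last by lra.
rewrite [n.+2`!]factS natrM [t ^+ n.+2]exprS.
have -> : 16 * (t * t ^+ n.+1 / (n.+2%:R * n.+1`!%:R)) =
    - (t ^+ n.+1 / n.+1`!%:R) * (- t * 16 / n.+2%:R).
  by field; rewrite -natrD !pnatr_eq0 -!lt0n fact_gt0.
rewrite ler_peMr//.
  by rewrite -mulNr divr_ge0// oppr_ge0 exprn_odd_le0// ltW.
rewrite ler_pdivlMr// mul1r.
have : n.+2%:R <= n.+1%:R * 2 :> R by rewrite -natrM ler_nat; lia.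
lra.
Qed.

(** Two steps down from an even order lead to an even order, so the bounds on
    one and two steps iterate. *)
Lemma texp_sub_le D j t : ~~ odd D -> (j <= D)%N ->
  `|texp (D - j) t| <= 13 ^+ j * texp D t.
Proof.
elim/ltn_ind: j D => -[|[|j]] IH D eD jD.
- by rewrite subn0 expr0 mul1r ger0_norm// texp_even_ge0.
- case: D eD jD => // n; rewrite /= negbK subn1 expr1 => on _.
  exact: texp_pred_le.
- case: D eD jD => [|[|n]]//; rewrite /= negbK => en jn.
  rewrite subSS subSS; apply: (le_trans (IH j _ n en jn)) => //.
  rewrite -[j.+2]addn2 exprD -mulrA ler_wpM2l ?exprn_ge0//.
  exact: texp_pred2_le.
Qed.

Lemma even_monomial_le n t : ~~ odd n -> t ^+ n / n`!%:R <= 9 * texp n t.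
Proof.
case: n => [_|n]; last by rewrite /= negbK; exact: last_monomial_le.
by rewrite texp0 expr0 fact0 divr1; lra.
Qed.

(** The monomial of odd order [n.+1] is interpolated between its two even
    neighbours by the arithmetic-geometric mean inequality, with an arbitrarily
    small weight on the higher one. *)
Lemma texp_odd_le n t (e : R) : ~~ odd n -> 0 < e ->
  `|texp n.+1 t| <= 9 * e * texp n.+2 t + (1 + 9 / e) * texp n t.
Proof.
move=> en e0.
have en2 : ~~ odd n.+2 by rewrite /= negbK.
have a0 : 0 <= t ^+ n / n`!%:R by rewrite divr_ge0// exprn_even_ge0.
have h0 := even_monomial_le t en.
have h2 := even_monomial_le t en2.
have : `|t ^+ n.+1 / n.+1`!%:R| <=
    e * (t ^+ n.+2 / n.+2`!%:R) + e^-1 * (t ^+ n / n`!%:R).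
  have -> : t ^+ n.+1 / n.+1`!%:R = (t ^+ n / n`!%:R) * (t / n.+1%:R).
    rewrite factS natrM exprSr.
    by field; rewrite nat1r !pnatr_eq0 -!lt0n fact_gt0.
  have -> : t ^+ n.+2 / n.+2`!%:R =
      (t ^+ n / n`!%:R) * (t ^+ 2 / (n.+1%:R * n.+2%:R)).
    rewrite !factS !natrM !exprSr expr0 mul1r.
    by field; rewrite nat1r -natrD !pnatr_eq0 -!lt0n fact_gt0.
  rewrite normrM (ger0_norm a0) mulrCA [e^-1 * _]mulrC -mulrDr.
  apply: ler_wpM2l => //.
  rewrite normf_div -(real_normK (num_real t)).
  set s := `|t|; have s0 : 0 <= s by exact: normr_ge0.
  rewrite [`|_%:R|]ger0_norm//.
  set b : R := n.+1%:R; set c : R := n.+2%:R.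
  have b0 : 0 < b by rewrite ltr0n.
  have c0 : 0 < c by rewrite ltr0n.
  have cb : c <= 2 * b by rewrite -natrM ler_nat; lia.
  have bc : b <= c by rewrite ler_nat.
  have h : 0 <= (e * s / c - 1) ^+ 2 by exact: sqr_ge0.
  have hs : s / b <= 2 * (s / c).
    rewrite ler_pdivrMr// mulrAC mulrA ler_pdivlMr//.
    by have := ler_wpM2l s0 cb; lra.
  have hs2 : s ^+ 2 / (c * c) <= s ^+ 2 / (b * c).
    rewrite ler_wpM2l ?exprn_ge0// lef_pV2 ?posrE ?mulr_gt0//.
    by rewrite ler_wpM2r// ltW.
  apply: (le_trans hs).
  apply: (@le_trans _ _ (e * (s ^+ 2 / (c * c)) + e^-1)); last first.
    by rewrite lerD2r ler_wpM2l// ltW.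
  rewrite -subr_ge0.
  have -> : e * (s ^+ 2 / (c * c)) + e^-1 - 2 * (s / c) =
     (e * s / c - 1) ^+ 2 / e by field; rewrite !gt_eqF.
  by rewrite divr_ge0// ltW.
move=> h1; rewrite texpS; apply: (le_trans (ler_normD _ _)).
rewrite (ger0_norm (texp_even_ge0 t en)).
have e2 : e * (t ^+ n.+2 / n.+2`!%:R) <= e * (9 * texp n.+2 t).
  by rewrite ler_wpM2l// ltW.
have e3 : e^-1 * (t ^+ n / n`!%:R) <= e^-1 * (9 * texp n t).
  by rewrite ler_wpM2l// ltW// invr_gt0.
lra.
Qed.

End TexpRatios.

(** * Truncated exponential series as polynomials *)
Section TruncatedPolynomials.
Context {R : realType}.
Implicit Types (p q : {poly R}) (a b x t : R) (D : nat).

Lemma texp_le_expR n t : 0 <= t -> texp n t <= expR t.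
Proof.
move=> t0; case: n => [|n]; first by rewrite texp0 -expR0 ler_expR.
rewrite -[leRHS]mul1r -ler_pdivrMr ?expR_gt0// -expRN mulrC.
have -> : 1 = expR (- 0) * texp n.+1 0 :> R by rewrite texp_at0 oppr0 expR0 mulr1.
apply: (derive_le0_noninc (is_derive_expR_texp n)) => // x /andP[x0 _].
by rewrite oppr_le0 mulr_ge0 ?expR_ge0// divr_ge0// exprn_ge0.
Qed.

(** Congruence modulo ['X^D.+1], in which formal power series are handled. *)
Definition eqcoef D p q := forall k, (k <= D)%N -> p`_k = q`_k.

Lemma eqcoef_trans D p q s : eqcoef D p q -> eqcoef D q s -> eqcoef D p s.
Proof. by move=> h1 h2 k kD; rewrite h1// h2. Qed.

Lemma eqcoefM D p p' q q' :
  eqcoef D p p' -> eqcoef D q q' -> eqcoef D (p * q) (p' * q').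
Proof.
move=> hp hq k kD; rewrite !coefM; apply: eq_bigr => i _.
by rewrite hp ?hq//; have := ltn_ord i; lia.
Qed.

Lemma eqcoef_prod D (I : finType) (f g : I -> {poly R}) :
  (forall i, eqcoef D (f i) (g i)) -> eqcoef D (\prod_i f i) (\prod_i g i).
Proof.
move=> fg; apply: (big_ind2 (eqcoef D)) => // *; exact: eqcoefM.
Qed.

Definition exp_poly D a : {poly R} := \poly_(k < D.+1) (a ^+ k / k`!%:R).

Lemma coef_exp_poly D a k : (k <= D)%N -> (exp_poly D a)`_k = a ^+ k / k`!%:R.
Proof. by move=> kD; rewrite coef_poly ltnS kD. Qed.

Lemma exp_poly0 D : eqcoef D (exp_poly D 0) 1.
Proof.
move=> k kD; rewrite coef_exp_poly// coef1; case: k {kD} => [|k].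
  by rewrite expr0 fact0 divr1.
by rewrite expr0n mul0r.
Qed.

Lemma exp_polyD D a b : eqcoef D (exp_poly D a * exp_poly D b) (exp_poly D (a + b)).
Proof.
move=> k kD; rewrite coefM coef_exp_poly// addrC exprDn mulr_suml.
apply: eq_bigr => i _; have ik : (i <= k)%N by have := ltn_ord i; lia.
rewrite !coef_exp_poly; try by lia.
have -> : k`!%:R = ('C(k, i) * (i`! * (k - i)`!))%:R :> R by rewrite bin_fact.
rewrite !natrM -[_ *+ 'C(_, _)]mulr_natr.
have : 'C(k, i)%:R != 0 :> R by rewrite pnatr_eq0 -lt0n bin_gt0.
have f n : n`!%:R != 0 :> R by rewrite pnatr_eq0 -lt0n fact_gt0.
move: ('C(k, i)%:R : R) (f i) (f (k - i)%N) => c f1 f2 c0.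
by field; rewrite f1 f2 c0.
Qed.

Lemma exp_poly_sum D (I : finType) (a : I -> R) :
  eqcoef D (\prod_i exp_poly D (a i)) (exp_poly D (\sum_i a i)).
Proof.
apply: (big_ind2 (fun p s => eqcoef D p (exp_poly D s))) => [|p s q s' hp hq|//].
  by move=> k kD; rewrite exp_poly0.
exact: eqcoef_trans (eqcoefM hp hq) (exp_polyD _ _).
Qed.

(** Majorants multiply, and the value of a majorant at [x] bounds the
    weighted [l^1] norm of the coefficients; this replaces Cauchy estimates. *)
Definition majorant p q := forall k, `|p`_k| <= q`_k.

Lemma majorantM p p' q q' :
  majorant p q -> majorant p' q' -> majorant (p * p') (q * q').
Proof.
move=> hp hq k; rewrite !coefM; apply: le_trans (ler_norm_sum _ _ _) _.
by apply: ler_sum => i _; rewrite normrM ler_pM.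
Qed.

Lemma majorant1 : majorant 1 1.
Proof. by move=> k; rewrite coef1; case: eqP => _; rewrite ?normr1 ?normr0. Qed.

Lemma majorant_prod (I : finType) (f g : I -> {poly R}) :
  (forall i, majorant (f i) (g i)) -> majorant (\prod_i f i) (\prod_i g i).
Proof.
move=> fg; apply: (big_ind2 majorant) => // *; first exact: majorant1.
exact: majorantM.
Qed.

Lemma majorant_horner D p q x : 0 <= x -> majorant p q ->
  \sum_(k < D.+1) `|p`_k| * x ^+ k <= q.[x].
Proof.
move=> x0 pq; rewrite (horner_coef_wide _ (leq_maxr D.+1 (size q))).
have q0 k : 0 <= q`_k by exact: le_trans (pq k).
rewrite -(big_mkord xpredT (fun k => `|p`_k| * x ^+ k)).
rewrite -(big_mkord xpredT (fun k => q`_k * x ^+ k)).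
rewrite [leRHS](@big_cat_nat _ _ _ D.+1) ?leq_maxl//=.
rewrite -[leLHS]addr0 lerD//.
  by apply: ler_sum => i _; rewrite ler_wpM2r ?exprn_ge0.
by apply: sumr_ge0 => i _; rewrite mulr_ge0 ?exprn_ge0.
Qed.

Lemma horner_exp_poly D a x : (exp_poly D a).[x] = texp D (a * x).
Proof.
rewrite horner_poly; apply: eq_bigr => i _; rewrite exprMn; ring.
Qed.

Lemma majorant_exp_poly D a : majorant (exp_poly D a) (exp_poly D `|a|).
Proof.
move=> k; rewrite !coef_poly; case: ifP => _; last by rewrite normr0.
by rewrite normrM normrX normfV [`|_`!%:R|]ger0_norm.
Qed.

(** [(1 + r 'X) * exp (- r 'X)] modulo ['X^D.+1]: there is no linear term, so that
    a product of such factors is controlled by the sum of the [r ^+ 2]. *)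
Definition damped D (r : R) : {poly R} :=
  \poly_(k < D.+1) ((1 - k%:R) * ((- r) ^+ k / k`!%:R)).

Lemma dampedE D r : eqcoef D ((1 + r *: 'X) * exp_poly D (- r)) (damped D r).
Proof.
move=> k kD; rewrite mulrDl mul1r -scalerAl coefD coefZ coefXM coef_exp_poly//.
rewrite [(damped D r)`_k]coef_poly ltnS kD; case: k kD => [|k] kD /=.
  by rewrite mulr0 addr0 subr0 mul1r.
rewrite coef_exp_poly; last by lia.
rewrite factS natrM exprS.
by field; rewrite nat1r !pnatr_eq0 -!lt0n fact_gt0.
Qed.

Definition damped_majorant D (r : R) : {poly R} :=
  \poly_(k < D.+1) (`|1 - k%:R| * (`|r| ^+ k / k`!%:R)).

Lemma majorant_damped D r : majorant (damped D r) (damped_majorant D r).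
Proof.
move=> k; rewrite !coef_poly; case: ifP => _; last by rewrite normr0.
by rewrite !normrM normrX normrN normfV [`|_`!%:R|]ger0_norm.
Qed.

(** As [(k - 1) / k! <= 1 / (k - 2)!], the value is at most [1 + w ^ 2 exp w] with
    [w = |r| x]. *)
Lemma horner_damped_majorant_le D r x : 0 <= x ->
  (damped_majorant D r).[x] <= expR ((`|r| * x) ^+ 2 * expR (`|r| * x)).
Proof.
move=> x0; set w := `|r| * x; have w0 : 0 <= w by rewrite mulr_ge0.
apply: le_trans (expR_ge1Dx _).
have -> : (damped_majorant D r).[x] =
    \sum_(k < D.+1) `|1 - k%:R| * (w ^+ k / k`!%:R).
  by rewrite horner_poly; apply: eq_bigr => i _; rewrite exprMn; ring.
move: w w0 => {x x0} w w0.
rewrite big_ord_recl subr0 normr1 mul1r expr0 fact0 divr1 lerD2l.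
case: D => [|D].
  by rewrite big_ord0 mulr_ge0 ?exprn_ge0 ?expR_ge0.
rewrite big_ord_recl subrr normr0 mul0r add0r.
case: D => [|D].
  by rewrite big_ord0 mulr_ge0 ?exprn_ge0 ?expR_ge0.
apply: (@le_trans _ _ (w ^+ 2 * texp D w)); last first.
  by rewrite ler_wpM2l ?exprn_ge0// texp_le_expR.
rewrite mulr_sumr; apply: ler_sum => m _.
rewrite !lift0 -[m.+2]add2n exprD.
have -> : `|1 - (2 + m)%:R| * (w ^+ 2 * w ^+ m / (2 + m)`!%:R) =
    w ^+ 2 * (w ^+ m * (`|1 - (2 + m)%:R| / (2 + m)`!%:R)) by ring.
rewrite ler_wpM2l ?exprn_ge0// ler_wpM2l ?exprn_ge0//.
have f0 : 0 < m`!%:R :> R by rewrite ltr0n fact_gt0.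
have -> : (1 - (2 + m)%:R : R) = - (m.+1%:R) by rewrite natrD -natr1; lra.
rewrite normrN ger0_norm// add2n !factS !natrM ler_pdivrMr ?mulr_gt0//.
have -> : m`!%:R^-1 * (m.+2%:R * (m.+1%:R * m`!%:R)) = m.+2%:R * m.+1%:R :> R.
  by field; rewrite pnatr_eq0 -lt0n fact_gt0.
by rewrite ler_peMl// ler1n.
Qed.

End TruncatedPolynomials.

(** * Elementary symmetric sums *)
Section ElementarySymmetric.
Context {R : realType}.
Implicit Types (t : R) (D N : nat).

Definition elem_sum N D (r : 'I_N -> R) : R :=
  \sum_(T : {set 'I_N} | (#|T| <= D)%N) \prod_(i in T) r i.

Lemma elem_sumE N D (r : 'I_N -> R) :
  elem_sum D r = \sum_(d < D.+1) (\prod_i (1 + r i *: 'X))`_d.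
Proof.
have -> : \prod_i (1 + r i *: 'X) =
    \sum_(T : {set 'I_N}) \prod_i (if i \in T then r i *: 'X else 1).
  by under eq_bigr do rewrite addrC; rewrite bigA_distr.
under eq_bigr do rewrite coef_sum.
rewrite exchange_big /elem_sum big_mkcond /=; apply: eq_bigr => T _.
rewrite -big_mkcond /= scaler_prod prodr_const.
under [RHS]eq_bigr do rewrite coefZ coefXn.
case: leqP => [TD|DT].
  rewrite (bigD1 (Ordinal (TD : (#|T| < D.+1)%N)))//= eqxx mulr1 [X in _ + X]big1 ?addr0//.
  move=> i /eqP iT; case: eqP => [e|_]; last by rewrite mulr0.
  by case: iT; apply/val_inj.
rewrite [RHS]big1// => i _; case: eqP => [e|_]; last by rewrite mulr0.
by have := ltn_ord i; rewrite e ltnS leqNgt DT.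
Qed.

(** Partial sums of a Cauchy product. *)
Lemma triangular_sum (a b : nat -> R) D :
  \sum_(d < D.+1) \sum_(j < d.+1) a j * b (d - j)%N =
  \sum_(j < D.+1) a j * \sum_(k < (D - j).+1) b k.
Proof.
elim: D => [|D IH]; first by rewrite !big_ord1.
rewrite big_ord_recr IH /= [RHS]big_ord_recr /= subnn big_ord1.
rewrite [X in _ + X = _]big_ord_recr /= subnn addrA -big_split /=; congr (_ + _).
apply: eq_bigr => j _; rewrite subSn; last by have := ltn_ord j; lia.
by rewrite -mulrDr [in RHS]big_ord_recr.
Qed.

(** Dividing [prod (1 + r_i X)] by [exp (t X)] leaves
    [h = exp ((sum r_i - t) X) * prod (1 + r_i X) exp (- r_i X)], whose majorant at
    13 involves [r] only through [sum r_i - t] and [sum r_i ^+ 2]. *)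
Lemma elem_sum_expansion N D (r : 'I_N -> R) t (K1 K2 : R) :
  `|\sum_i r i - t| <= K1 -> \sum_i r i ^+ 2 <= K2 ->
  exists h : nat -> R,
    [/\ h 0 = 1,
      elem_sum D r = \sum_(j < D.+1) h j * texp (D - j) t &
      \sum_(j < D.+1) `|h j| * 13 ^+ j <=
        expR (K1 * 13 + 13 ^+ 2 * K2 * expR (13 * (1 + K2)))].
Proof.
move=> rK1 rK2; set dl := \sum_i r i - t.
pose h := exp_poly D dl * \prod_i damped D (r i).
have hE : eqcoef D (\prod_i (1 + r i *: 'X)) (h * exp_poly D t).
  move=> k kD.
  have -> : (h * exp_poly D t)`_k =
      ((\prod_i (1 + r i *: 'X)) *
        (exp_poly D dl * exp_poly D (\sum_i - r i) * exp_poly D t))`_k.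
    have -> : \prod_i (1 + r i *: 'X) *
         (exp_poly D dl * exp_poly D (\sum_i - r i) * exp_poly D t) =
       exp_poly D dl * ((\prod_i (1 + r i *: 'X)) * exp_poly D (\sum_i - r i)) * exp_poly D t.
      by rewrite !mulrA [X in X * _ * _]mulrC.
    apply: eqcoefM (kD) => //; apply: eqcoefM => //.
    apply: (@eqcoef_trans _ _ _
      (\prod_i ((1 + r i *: 'X) * exp_poly D (- r i)))).
      by apply: eqcoef_prod => i l lD; rewrite dampedE.
    rewrite big_split /=; apply: eqcoefM => //; exact: exp_poly_sum.
  rewrite -[in LHS](mulr1 (\prod_i (1 + r i *: 'X))).
  apply: eqcoefM (kD) => //.
  move=> l lD; symmetry; move: l lD.
  apply: (@eqcoef_trans _ _ _ (exp_poly D (dl + \sum_i - r i + t))).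
    move=> l lD; rewrite -exp_polyD//.
    by apply: eqcoefM (lD) => //; exact: exp_polyD.
  have -> : dl + \sum_i - r i + t = 0 by rewrite sumrN /dl; lra.
  exact: exp_poly0.
have h0 : h`_0 = 1.
  have := hE 0 (leq0n _).
  rewrite coef0M coef_exp_poly// expr0 fact0 divr1 mulr1 => <-.
  rewrite -horner_coef0 horner_prod big1// => i _.
  by rewrite hornerE hornerE hornerZ hornerX mulr0 addr0.
exists (fun j => h`_j); split => //.
  rewrite elem_sumE.
  rewrite -(triangular_sum (fun j => h`_j) (fun k => t ^+ k / k`!%:R)).
  apply: eq_bigr => d _.
  rewrite hE ?coefM; last by have := ltn_ord d; lia.
  apply: eq_bigr => j _; rewrite coef_exp_poly//.
  by have := ltn_ord d; lia.
have hm : majorant h (exp_poly D `|dl| * \prod_i damped_majorant D (r i)).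
  apply: majorantM; first exact: majorant_exp_poly.
  by apply: majorant_prod => i; exact: majorant_damped.
apply: (le_trans (majorant_horner D (ler0n _ 13) hm)).
rewrite hornerM horner_exp_poly horner_prod expRD.
have r2 i : `|r i| ^+ 2 <= K2.
  rewrite real_normK ?num_real//; apply: le_trans rK2.
  by rewrite (bigD1 i)//= lerDl sumr_ge0// => *; exact: sqr_ge0.
have K20 : 0 <= K2 by apply: le_trans rK2; apply: sumr_ge0 => *; exact: sqr_ge0.
apply: ler_pM.
- by rewrite texp_ge0// mulr_ge0.
- by apply: prodr_ge0 => i _; rewrite horner_poly sumr_ge0.
- have dl0 : 0 <= `|dl| * 13 by rewrite mulr_ge0.
  by apply: (le_trans (texp_le_expR D dl0)); rewrite ler_expR ler_wpM2r.
apply: (@le_trans _ _ (\prod_i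
    expR ((`|r i| * 13) ^+ 2 * expR (`|r i| * 13)))).
  apply: ler_prod => i _; rewrite horner_damped_majorant_le// andbT.
  by rewrite horner_poly sumr_ge0.
rewrite -expR_sum ler_expR.
apply: (@le_trans _ _ (\sum_i 13 ^+ 2 * r i ^+ 2 * expR (13 * (1 + K2)))).
  apply: ler_sum => i _; rewrite exprMn real_normK ?num_real//.
  rewrite [13 ^+ 2 * _]mulrC ler_wpM2l//.
    by rewrite mulr_ge0 ?sqr_ge0 ?exprn_ge0.
  rewrite ler_expR mulrC ler_wpM2l//.
  have := r2 i; have : 0 <= (`|r i| - 1) ^+ 2 by exact: sqr_ge0.
  have := normr_ge0 (r i).
  by nra.
by rewrite -mulr_suml -mulr_sumr ler_wpM2r ?expR_ge0// ler_wpM2l.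
Qed.

(** In the lower bound the weight [e] is such that [texp_odd_le] spends half of
    the leading term on the term [j = 1] of the expansion. *)
Theorem elem_sum_texp_bounds (K1 K2 : R) :
  exists2 C : R, 0 < C & forall N (r : 'I_N -> R) t,
    `|\sum_i r i - t| <= K1 -> \sum_i r i ^+ 2 <= K2 ->
    forall D, ~~ odd D ->
      elem_sum D r <= C * texp D t /\
      2^-1 * texp D t - C * exp_trunc (D%:Z - 2) t <= elem_sum D r.
Proof.
set M := expR (K1 * 13 + 13 ^+ 2 * K2 * expR (13 * (1 + K2))).
have M0 : 0 < M by exact: expR_gt0.
pose e := (2 * 9 * M)^-1.
have e0 : 0 < e by rewrite invr_gt0 mulr_gt0.
have eM0 : 0 <= M * (1 + 9 / e).
  by rewrite mulr_ge0 ?addr_ge0 ?divr_ge0 ?ltW.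
exists (M * (1 + 9 / e) + M); first by rewrite ltr_wpDl.
move=> N r t rK1 rK2 D eD.
have [h [h0 hE hM]] := elem_sum_expansion D rK1 rK2.
have ED0 := texp_even_ge0 t eD.
have upper : elem_sum D r <= M * texp D t.
  rewrite hE; apply: (@le_trans _ _ (\sum_(j < D.+1) `|h j| * 13 ^+ j * texp D t)).
    apply: ler_sum => j _; apply: le_trans (ler_norm _) _.
    by rewrite normrM -mulrA ler_wpM2l// texp_sub_le// -ltnS.
  by rewrite -mulr_suml ler_wpM2r.
split.
  by apply: (le_trans upper); rewrite ler_wpM2r// lerDr.
case: D eD hE hM ED0 {upper} => [|[|n]]// en hE hM ED0.
  rewrite hE big_ord1 h0 mul1r subn0 texp0 mulr1 /exp_trunc /= mulr0 subr0.
  by lra.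
have {}en : ~~ odd n by move: en; rewrite /= negbK.
have -> : (n.+2%:Z - 2)%R = n%:Z :> int by lia.
have -> : exp_trunc n t = texp n t by [].
have En0 := texp_even_ge0 t en.
have E1 := texp_odd_le t en e0.
rewrite hE big_ord_recl h0 mul1r subn0 big_ord_recl lift0 /= subn1.
have h1 : `|h 1| <= M.
  apply: le_trans hM; rewrite big_ord_recl big_ord_recl lift0 /= expr1.
  have : 0 <= `|h 1| by [].
  have : 0 <= \sum_(i < n.+1) `|h (lift ord0 (lift ord0 i))| *
                13 ^+ (lift ord0 (lift ord0 i)) :> R.
    by apply: sumr_ge0 => i _; rewrite mulr_ge0 ?exprn_ge0.
  by have : 0 <= `|h 0| * 13 ^+ 0 by []; lra.
have tail : `|\sum_(i < n.+1) h (lift ord0 (lift ord0 i)) *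
     texp (n.+2 - lift ord0 (lift ord0 i)) t| <= M * texp n t.
  apply: (le_trans (ler_norm_sum _ _ _)).
  apply: (@le_trans _ _ (\sum_(i < n.+1) `|h (lift ord0 (lift ord0 i))| *
                13 ^+ (lift ord0 (lift ord0 i)) * texp n t)).
    apply: ler_sum => j _; rewrite normrM -mulrA ler_wpM2l//.
    rewrite !lift0 !subSS; apply: (le_trans (texp_sub_le t en _)).
      by rewrite -ltnS.
    by rewrite ler_wpM2r// ler_weXn2l ?ler1n// !leqW.
  rewrite -mulr_suml ler_wpM2r//; apply: le_trans hM.
  rewrite [leRHS]big_ord_recl [X in _ <= _ + X]big_ord_recl.
  by rewrite addrA lerDr addr_ge0// mulr_ge0 ?exprn_ge0.
have := ler_wpM2r (normr_ge0 (texp n.+1 t)) h1.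
rewrite -normrM => h1E.
have h2E := ler_wpM2l (ltW M0) E1.
have Me : M * (9 * e * texp n.+2 t) = 2^-1 * texp n.+2 t.
  by rewrite /e; field; rewrite gt_eqF.
rewrite mulrDr Me mulrA in h2E.
move: h1E h2E tail; rewrite !ler_norml mulrDl.
set a := h 1 * _; set b := \sum_(i < _) _.
lra.
Qed.

End ElementarySymmetric.

(** * Second-order expansion of a symmetric function vanishing on the axes *)
Section Partials.
Context {R : realType}.
Implicit Types (f : R * R -> R) (a b : R).

(** The difference quotient defining the partial derivative is that of a
    function of one real variable. *)
Lemma shift_partial1 f a b :
  (fun h : R => h^-1 *: ((f \o shift (a, b)) (h *: (1 : R, 0 : R)) - f (a, b))) =
  (fun h : R => h^-1 *: (((fun u => f (u, b)) \o shift a) (h *: (1 : R)) - f (a, b))).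
Proof.
apply/funext => h /=; congr (_ *: (f _ - _)).
by rewrite [LHS]surjective_pairing /=; congr pair; rewrite [_ *: 0]mulr0 add0r.
Qed.

Lemma shift_partial2 f a b :
  (fun h : R => h^-1 *: ((f \o shift (a, b)) (h *: (0 : R, 1 : R)) - f (a, b))) =
  (fun h : R => h^-1 *: (((fun u => f (a, u)) \o shift b) (h *: (1 : R)) - f (a, b))).
Proof.
apply/funext => h /=; congr (_ *: (f _ - _)).
by rewrite [LHS]surjective_pairing /=; congr pair; rewrite [_ *: 0]mulr0 add0r.
Qed.

Lemma is_derive_partial1 f a b : derivable f (a, b) (1 : R, 0 : R) ->
  is_derive a (1 : R) (fun u => f (u, b)) (partial1 f (a, b)).
Proof.
move=> df; split.
  by move: df; rewrite /derivable shift_partial1.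
by rewrite /partial1 /derive shift_partial1.
Qed.

Lemma is_derive_partial2 f a b : derivable f (a, b) (0 : R, 1 : R) ->
  is_derive b (1 : R) (fun u => f (a, u)) (partial2 f (a, b)).
Proof.
move=> df; split.
  by move: df; rewrite /derivable shift_partial2.
by rewrite /partial2 /derive shift_partial2.
Qed.

Lemma mean_value (f df : R -> R) a b :
  (forall x, (a <= x <= b) || (b <= x <= a) -> is_derive x (1 : R) f (df x)) ->
  exists2 c, (a <= c <= b) || (b <= c <= a) & f b - f a = df c * (b - a).
Proof.
wlog ab : a b / a <= b => [hw|] fdf.
  have [/hw|/ltW /hw] := leP a b; first by move=> /(_ fdf).
  case=> [x xab|c cab e]; first by apply: fdf; rewrite orbC.
  by exists c; [rewrite orbC|rewrite -opprB e -mulrN opprB].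
have cf : {within `[a, b], continuous f}.
  apply: continuous_in_subspaceT => x; rewrite inE /= in_itv /= => xab.
  have D := fdf x _; apply/differentiable_continuous/derivable1_diffP.
  by apply: ex_derive; apply: D; rewrite xab.
have D x : x \in `]a, b[ -> is_derive x (1 : R) f (df x).
  by rewrite in_itv /= => /andP[/ltW ax /ltW xb]; apply: fdf; rewrite ax xb.
have [c cab e] := MVT_segment ab D cf.
by exists c => //; rewrite in_itv /= in cab; rewrite cab.
Qed.

End Partials.

Section Box.
Context {R : realType}.
Variables (A : R) (U : set (R * R)).
Hypotheses (A0 : 0 < A) (AU : `[- A, A] `*` `[- A, A] `<=` U).
Implicit Types (f : R * R -> R) (a b x y : R).

Let inU a b : `|a| <= A -> `|b| <= A -> U (a, b).
Proof.
by move=> aA bA; apply: AU; split; rewrite /= in_itv /= -ler_norml.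
Qed.

Let between a b c : (a <= c <= b) || (b <= c <= a) ->
  `|a| <= A -> `|b| <= A -> `|c| <= A.
Proof. by rewrite !ler_norml; lra. Qed.

(** Pointwise existence only: the mean value theorems need no continuity of the
    derivatives. *)
Definition has_partials f := forall z, U z ->
  derivable f z (1 : R, 0 : R) /\ derivable f z (0 : R, 1 : R).

Lemma mean_value1 f a x b : has_partials f -> `|a| <= A -> `|x| <= A -> `|b| <= A ->
  exists2 c, (a <= c <= x) || (x <= c <= a) &
    f (x, b) - f (a, b) = partial1 f (c, b) * (x - a).
Proof.
move=> df aA xA bA.
apply: (@mean_value _ (fun u => f (u, b)) (fun u => partial1 f (u, b))) => u ux.
by apply: is_derive_partial1; have [] := df _ (inU (between ux aA xA) bA).
Qed.

Lemma mean_value2 f a b y : has_partials f -> `|a| <= A -> `|b| <= A -> `|y| <= A ->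
  exists2 c, (b <= c <= y) || (y <= c <= b) &
    f (a, y) - f (a, b) = partial2 f (a, c) * (y - b).
Proof.
move=> df aA bA yA.
apply: (@mean_value _ (fun u => f (a, u)) (fun u => partial2 f (a, u))) => u uy.
by apply: is_derive_partial2; have [] := df _ (inU aA (between uy bA yA)).
Qed.

(** The mean value theorem in the second variable, for the difference of two
    sections, and then in the first variable. *)
Lemma double_difference f a x b y : has_partials f -> has_partials (partial2 f) ->
  `|a| <= A -> `|x| <= A -> `|b| <= A -> `|y| <= A ->
  exists c e, [/\ (a <= c <= x) || (x <= c <= a),
    (b <= e <= y) || (y <= e <= b) &
    f (x, y) - f (a, y) - (f (x, b) - f (a, b)) =
      partial1 (partial2 f) (c, e) * (x - a) * (y - b)].
Proof.
move=> df d2f aA xA bA yA.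
have [] := @mean_value _ (fun u => f (x, u) - f (a, u))
  (fun u => partial2 f (x, u) - partial2 f (a, u)) b y.
  move=> u uy; have uA := between uy bA yA.
  have [_ dx] := df _ (inU xA uA); have [_ da] := df _ (inU aA uA).
  have D1 := is_derive_partial2 dx; have D2 := is_derive_partial2 da.
  exact: is_deriveB.
move=> e ey /= eE; have eA := between ey bA yA.
have [c cx cE] := mean_value1 d2f aA xA eA.
by exists c, e; split => //; rewrite eE cE.
Qed.

Lemma bounded_on_box f : (forall z, U z -> {for z, continuous f}) ->
  exists2 M : R, 0 <= M & forall a b, `|a| <= A -> `|b| <= A -> `|f (a, b)| <= M.
Proof.
move=> cf.
have cg : {within `[- A, A] `*` `[- A, A], continuous (fun z => `|f z|)}.
  apply: continuous_in_subspaceT => z; rewrite inE => /AU Uz.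
  by apply: continuous_comp; [exact: cf|exact: norm_continuous].
have Q0 : (`[- A, A] `*` `[- A, A]) !=set0.
  by exists (0, 0); split; rewrite /= in_itv /= oppr_le0 ltW.
have K := compact_setX (@segment_compact _ (- A) A) (@segment_compact _ (- A) A).
have [c _ hc] := compact_EVT_max Q0 K cg.
exists `|f c| => // a b aA bA; apply: hc; rewrite inE.
by split; rewrite /= in_itv /= -ler_norml.
Qed.

End Box.

Lemma class_CS (R : realType) k (U : set (R * R)) (f : R * R -> R) :
  class_C k.+1 U f ->
  [/\ forall z, U z -> {for z, continuous f}, has_partials U f,
      class_C k U (partial1 f) & class_C k U (partial2 f)].
Proof. by case=> cf []. Qed.

Lemma norm_between0 (R : realType) (a c : R) :
  (0 <= c <= a) || (a <= c <= 0) -> `|c| <= `|a|.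
Proof.
case/orP => /andP[h1 h2].
  by rewrite !ger0_norm//; exact: le_trans h2.
by rewrite !ler0_norm ?lerN2//; exact: le_trans h2.
Qed.

Lemma quadratic_form_le (R : realDomainType) (M1 M2 x y : R) :
  0 <= M1 -> 0 <= M2 -> (M1 * x + M2 * y) * x + M1 * y ^+ 2 <=
    2 * (M1 + M2) * (x ^+ 2 + y ^+ 2).
Proof.
move=> M10 M20; have := sqr_ge0 (x - y); rewrite sqrrB => xy.
have x2 := sqr_ge0 x; have y2 := sqr_ge0 y.
have l1 : M2 * (y * x) <= M2 * (x ^+ 2 + y ^+ 2) by rewrite ler_wpM2l//; lra.
have l2 : 0 <= M1 * (x ^+ 2 + y ^+ 2) by rewrite mulr_ge0// addr_ge0.
have l3 : 0 <= M2 * (x ^+ 2 + y ^+ 2) by rewrite mulr_ge0// addr_ge0.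
by lra.
Qed.

Lemma dist_between (R : realType) (a b c : R) :
  (a <= c <= b) || (b <= c <= a) -> `|a - c| <= `|b - a|.
Proof.
case/orP => /andP[h1 h2].
  by rewrite distrC !ger0_norm ?subr_ge0 ?lerD2r//; exact: le_trans h2.
rewrite [leRHS]distrC !ger0_norm ?subr_ge0 ?lerD2l ?lerN2//; exact: le_trans h2.
Qed.

(** The gradient of [g] vanishes at the origin: its first component by hypothesis,
    and the growth along the second axis is that along the first by symmetry.  So
    only second derivatives of the form [partial_ (partial1 g)] enter. *)
Lemma quadratic_growth (R : realType) (A : R) (U : set (R * R)) (g : R * R -> R) :
  0 < A -> `[- A, A] `*` `[- A, A] `<=` U ->
  has_partials U g -> has_partials U (partial1 g) ->
  (forall z, U z -> {for z, continuous (partial1 (partial1 g))}) ->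
  (forall z, U z -> {for z, continuous (partial2 (partial1 g))}) ->
  partial1 g (0, 0) = 0 ->
  (forall v, `|v| <= A -> g (0, v) = g (v, 0)) ->
  exists2 M : R, 0 <= M &
    forall a b, `|a| <= A -> `|b| <= A ->
      `|g (a, b) - g (0, 0)| <= M * (a ^+ 2 + b ^+ 2).
Proof.
move=> A0 AU C1g C1g1 c11 c21 g1_0 g_sym.
have A00 : `|0 : R| <= A by rewrite normr0 ltW.
have [M1 M10 B1] := bounded_on_box A0 AU c11.
have [M2 M20 B2] := bounded_on_box A0 AU c21.
have inb := @norm_between0 R.
have d1 a : `|a| <= A -> `|partial1 g (a, 0)| <= M1 * `|a|.
  move=> aA; have [c ca] := mean_value1 AU C1g1 A00 aA A00.
  rewrite g1_0 !subr0 => ->; rewrite normrM ler_wpM2r//.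
  by apply: B1 => //; exact: le_trans (inb _ _ ca) aA.
have d2 a b : `|a| <= A -> `|b| <= A ->
    `|partial1 g (a, b)| <= M1 * `|a| + M2 * `|b|.
  move=> aA bA; have [c cb] := mean_value2 AU C1g1 aA A00 bA.
  rewrite subr0 => E; rewrite -(subrK (partial1 g (a, 0)) (partial1 g (a, b))) E.
  apply: (le_trans (ler_normD _ _)); rewrite addrC lerD ?d1// normrM ler_wpM2r//.
  by apply: B2 => //; exact: le_trans (inb _ _ cb) bA.
have g0 a : `|a| <= A -> `|g (a, 0) - g (0, 0)| <= M1 * `|a| ^+ 2.
  move=> aA; have [c ca] := mean_value1 AU C1g A00 aA A00.
  rewrite subr0 => ->; rewrite normrM expr2 mulrA ler_wpM2r//.
  have ca' := inb _ _ ca.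
  by apply: (le_trans (d1 _ (le_trans ca' aA))); rewrite ler_wpM2l.
exists (2 * (M1 + M2)) => [|a b aA bA]; first by rewrite mulr_ge0// addr_ge0.
have [c ca] := mean_value1 AU C1g A00 aA bA; rewrite subr0 => E.
rewrite -(subrK (g (0, b)) (g (a, b))) E -addrA.
apply: (le_trans (ler_normD _ _)).
have ca' := inb _ _ ca.
rewrite (g_sym _ bA).
have h1 := g0 b bA.
have h2 : `|partial1 g (c, b) * a| <= (M1 * `|a| + M2 * `|b|) * `|a|.
  rewrite normrM ler_wpM2r//; apply: (le_trans (d2 _ _ (le_trans ca' aA) bA)).
  by rewrite lerD2r ler_wpM2l.
apply: (le_trans (lerD h2 h1)).
rewrite -(real_normK (num_real a)) -(real_normK (num_real b)).
exact: quadratic_form_le.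
Qed.

Section MixedTaylor.
Context {R : realType}.
Variables (A : R) (U : set (R * R)) (f : R * R -> R).
Hypotheses (A0 : 0 < A) (AU : `[- A, A] `*` `[- A, A] `<=` U).
Hypothesis C4f : class_C 4 U f.
Hypothesis f_sym : forall a b, `|a| <= A -> `|b| <= A -> f (a, b) = f (b, a).
Hypothesis f_0 : forall a, `|a| <= A -> f (a, 0) = 0.
Hypothesis f_112 : partial1 (partial1 (partial2 f)) (0, 0) = 0.

Local Notation g := (partial1 (partial2 f)).

Let U2 a b : `|a| <= A -> `|b| <= A -> U (a, b).
Proof.
by move=> aA bA; apply: AU; split; rewrite /= in_itv /= -ler_norml.
Qed.

Let A00 : `|0 : R| <= A. Proof. by rewrite normr0 ltW. Qed.

Let C1f : has_partials U f.
Proof. by have [] := class_CS C4f. Qed.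

Let C3f2 : class_C 3 U (partial2 f).
Proof. by have [_ _ _] := class_CS C4f. Qed.

Let C1f2 : has_partials U (partial2 f).
Proof. by have [] := class_CS C3f2. Qed.

Let C2g : class_C 2 U g.
Proof. by have [_ _ h _] := class_CS C3f2. Qed.

(** Schwarz's theorem is replaced by the symmetry of [f]: the double difference over a
    small rectangle at [(0, v)] equals that over the reflected rectangle at
    [(v, 0)], and each is the area times a value of [g] close to the corner. *)
Lemma mixed_partial_sym v : `|v| <= A -> g (0, v) = g (v, 0).
Proof.
move=> vA; have [->//|v0] := eqVneq v 0.
apply/eqP; rewrite -subr_eq0 -normr_le0; apply/ler_addgt0Pl => e e0.
rewrite addr0; have e20 : 0 < e / 2 by rewrite divr_gt0.
have cg z : U z -> {for z, continuous g} by have [h _ _ _] := class_CS C2g; exact: h.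
have /cvgrPdist_lt/(_ _ e20)/nbhs_ballP[d1 /= d10 h1] := cg _ (U2 A00 vA).
have /cvgrPdist_lt/(_ _ e20)/nbhs_ballP[d2 /= d20 h2] := cg _ (U2 vA A00).
pose d := Num.min d1 d2.
have d0 : 0 < d by rewrite lt_min d10 d20.
(* the rectangle has sides [A * h] and [- v * h], which keeps it in the box *)
pose h := Num.min 1 (d / (2 * A)).
have h0 : 0 < h by rewrite lt_min ltr01 divr_gt0// mulr_gt0.
have h_le1 : h <= 1 by rewrite ge_min lexx.
have hd : A * h < d.
  have : h <= d / (2 * A) by rewrite ge_min lexx orbT.
  by rewrite ler_pdivlMr ?mulr_gt0//; lra.
have [dd1 dd2] : d <= d1 /\ d <= d2 by rewrite !ge_min !lexx orbT.
have AhA : `|A * h| <= A.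
  rewrite ger0_norm; last by rewrite mulr_ge0// ltW.
  by apply: ler_piMr => //; exact: ltW.
have vhA : `|v * (1 - h)| <= A.
  rewrite normrM (ger0_norm (_ : 0 <= 1 - h)) ?subr_ge0//.
  by apply: le_trans vA; apply: ler_piMr => //; rewrite gerBl ltW.
have vh : `|v * h| <= A * h by rewrite normrM (gtr0_norm h0) ler_wpM2r// ltW.
have Ah0 : 0 <= A * h by rewrite mulr_ge0 ?ltW.
have [c [c' [cb c'b E1]]] := double_difference AU C1f C1f2 A00 AhA vA vhA.
have [k [k' [kb k'b E2]]] := double_difference AU C1f C1f2 vA vhA A00 AhA.
have near_v w : (v <= w <= v * (1 - h)) || (v * (1 - h) <= w <= v) ->
    `|v - w| < d.
  move=> hw; apply: le_lt_trans hd; apply: le_trans vh.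
  apply: (le_trans (dist_between hw)).
  by rewrite mulrBr mulr1 addrAC subrr add0r normrN.
have near_0 w : (0 <= w <= A * h) || (A * h <= w <= 0) -> `|0 - w| < d.
  move=> hw; apply: le_lt_trans hd; apply: (le_trans (dist_between hw)).
  by rewrite subr0 ger0_norm.
have : g (c, c') = g (k, k').
  have fz a : `|a| <= A -> f (0, a) = 0 by move=> aA; rewrite f_sym// f_0.
  move: E2; rewrite (f_0 vhA) (f_0 vA) (f_sym vhA AhA) (f_sym vA AhA) subr0.
  move: E1; rewrite (fz _ vhA) (fz _ vA) !subr0 => -> .
  have nz : A * h * (v * h) != 0 by rewrite !mulf_neq0// gt_eqF.
  have -> : g (c, c') * (A * h) * (v * (1 - h) - v) =
     - (g (c, c') * (A * h * (v * h))) by ring.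
  have -> : g (k, k') * (v * (1 - h) - v) * (A * h) =
     - (g (k, k') * (A * h * (v * h))) by ring.
  by move/oppr_inj/(mulIf nz).
have : `|g (0, v) - g (c, c')| < e / 2.
  apply: h1; split; rewrite -ball_normE /=.
    exact: lt_le_trans (near_0 _ cb) dd1.
  exact: lt_le_trans (near_v _ c'b) dd1.
have : `|g (v, 0) - g (k, k')| < e / 2.
  apply: h2; split; rewrite -ball_normE /=.
    exact: lt_le_trans (near_v _ kb) dd2.
  exact: lt_le_trans (near_0 _ k'b) dd2.
move=> + + gE; rewrite gE.
move: (g (0, v)) (g (v, 0)) (g (k, k')) => p q r l1 l2.
rewrite -(subrK r p) -addrA; apply: (le_trans (ler_normD _ _)).
rewrite (distrC r) [e]splitr; exact: ltW (ltrD l2 l1).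
Qed.

(** As [f] vanishes on the axes, its value at [(a, b)] is the double difference
    over the rectangle with opposite corners [(0, 0)] and [(a, b)]. *)
Lemma bilinear_approx : exists2 M : R, 0 <= M &
  forall a b, `|a| <= A -> `|b| <= A ->
    `|f (a, b) - g (0, 0) * (a * b)| <= M * (`|a| * `|b| * (a ^+ 2 + b ^+ 2)).
Proof.
have [_ C1g C1_g1 _] := class_CS C2g.
have [_ C1g1 [c11 _] [c21 _]] := class_CS C1_g1.
have [M M0 gM] := quadratic_growth A0 AU C1g C1g1 c11 c21 f_112 mixed_partial_sym.
exists M => // a b aA bA.
have [c [e [ca eb]]] := double_difference AU C1f C1f2 A00 aA A00 bA.
have -> : f (0, b) = 0 by rewrite f_sym// f_0.
rewrite !(f_0 A00) (f_0 aA) !subr0 => ->.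
rewrite -mulrA -mulrBl.
rewrite normrM normrM [M * _]mulrCA [leLHS]mulrC ler_wpM2l ?mulr_ge0//.
have sq := @norm_between0 R.
have ca' := sq _ _ ca; have eb' := sq _ _ eb.
apply: (le_trans (gM _ _ (le_trans ca' aA) (le_trans eb' bA))).
rewrite ler_wpM2l//.
rewrite -!(real_normK (num_real a)) -(real_normK (num_real b)).
rewrite -!(real_normK (num_real c)) -(real_normK (num_real e)).
by rewrite lerD// lerXn2r// nnegrE.
Qed.

End MixedTaylor.

(** * Moments of the prior *)
Section PriorMoments.
Context {R : realType} {S : alphabet R} {N : nat}.
Implicit Types (x y : N.-tuple (letter S)).

Lemma norm_power_le k x (B : R) : (0 < k)%N -> 0 < B -> (0 < N)%N ->
  norm_power k x <= B * N%:R `^ (k%:R^-1 - 4^-1) ->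
  \sum_(i < N) `|tnth x i : R| ^+ k <= B ^+ k * N%:R `^ (1 - k%:R / 4).
Proof.
move=> k0 B0 N0 xB; set s := \sum_(i < N) _.
have s0 : 0 <= s by apply: sumr_ge0 => i _; rewrite exprn_ge0.
have kn : k%:R != 0 :> R by rewrite pnatr_eq0 -lt0n.
have -> : s = norm_power k x ^+ k.
  by rewrite /norm_power -powR_mulrn ?powR_ge0// -powRrM mulVf// powRr1.
have -> : N%:R `^ (1 - k%:R / 4) = (N%:R `^ (k%:R^-1 - 4^-1)) ^+ k :> R.
  rewrite -powR_mulrn ?powR_ge0// -powRrM; congr (_ `^ _).
  by rewrite mulrBl mulVf// [4^-1 * _]mulrC.
by rewrite -exprMn lerXn2r// nnegrE ?powR_ge0// mulr_ge0 ?powR_ge0// ltW.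
Qed.

(** The almost sure bounds on one draw of the prior. *)
Definition tame (A B2 B4 B6 : R) x :=
  [/\ norm_infty x <= A,
      norm_power 2 x <= B2 * N%:R `^ (2%:R^-1 - 4^-1),
      norm_power 4 x <= B4 * N%:R `^ (4%:R^-1 - 4^-1) &
      norm_power 6 x <= B6 * N%:R `^ (6%:R^-1 - 4^-1)].

Lemma norm_infty_le x (A : R) : norm_infty x <= A -> forall i, `|tnth x i : R| <= A.
Proof. by move=> xA i; apply: le_trans xA; exact: le_bigmax_cond. Qed.

Lemma tame_moments (A B2 B4 B6 : R) x : 0 < B2 -> 0 < B4 -> 0 < B6 -> (0 < N)%N ->
  tame A B2 B4 B6 x ->
  [/\ forall i, `|tnth x i : R| <= A,
    \sum_(i < N) `|tnth x i : R| ^+ 2 <= B2 ^+ 2 * Num.sqrt N%:R,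
    \sum_(i < N) `|tnth x i : R| ^+ 4 <= B4 ^+ 4 &
    \sum_(i < N) `|tnth x i : R| ^+ 6 <= B6 ^+ 6 / Num.sqrt N%:R].
Proof.
move=> B20 B40 B60 N0 [xA x2 x4 x6].
have := norm_power_le (isT : (0 < 2)%N) B20 N0 x2.
have := norm_power_le (isT : (0 < 4)%N) B40 N0 x4.
have := norm_power_le (isT : (0 < 6)%N) B60 N0 x6.
have -> : 1 - 6 / 4 = - 2^-1 :> R by lra.
have -> : 1 - 4 / 4 = 0 :> R by lra.
have -> : 1 - 2 / 4 = 2^-1 :> R by lra.
rewrite powRr0 mulr1 powRN powR12_sqrt// => h6 h4 h2.
by split => //; exact: norm_infty_le.
Qed.

(** Arithmetic-geometric mean with weights [sqrt N] and [1 / sqrt N], which cancel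
    the decay of the sixth moment and the growth of the second one. *)
Lemma sum_cube_mul_le x y (B2 B6 : R) : (0 < N)%N ->
  \sum_(i < N) `|tnth x i : R| ^+ 6 <= B6 ^+ 6 / Num.sqrt N%:R ->
  \sum_(i < N) `|tnth y i : R| ^+ 2 <= B2 ^+ 2 * Num.sqrt N%:R ->
  \sum_(i < N) `|tnth x i : R| ^+ 3 * `|tnth y i : R| <= (B6 ^+ 6 + B2 ^+ 2) / 2.
Proof.
move=> N0; set s : R := Num.sqrt _ => h6 h2.
have s0 : 0 < s by rewrite sqrtr_gt0 ltr0n.
apply: (@le_trans _ _
  (\sum_(i < N) (s * `|tnth x i : R| ^+ 6 + `|tnth y i : R| ^+ 2 / s) / 2)).
  apply: ler_sum => i _; rewrite ler_pdivlMr//.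
  set a := `|_|; set b := `|_ : R|; rewrite -subr_ge0.
  have -> : s * a ^+ 6 + b ^+ 2 / s - a ^+ 3 * b * 2 =
      (s * a ^+ 3 - b) ^+ 2 / s by field; rewrite gt_eqF.
  by rewrite divr_ge0 ?sqr_ge0// ltW.
rewrite -mulr_suml big_split /= -mulr_sumr -mulr_suml ler_pM2r ?invr_gt0//.
apply: lerD.
  by apply: (le_trans (ler_wpM2l (ltW s0) h6)); rewrite mulrCA mulfV ?mulr1// gt_eqF.
by rewrite ler_pdivrMr.
Qed.

(** The error terms sum to [O(1)] by [sum_cube_mul_le], and the squares of the main
    terms by the fourth moments. *)
Lemma overlap_moments (A B2 B4 B6 F M : R) (f : R * R -> R) x y :
  0 < B2 -> 0 < B4 -> 0 < B6 -> 0 <= M -> (0 < N)%N ->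
  (forall a b, `|a| <= A -> `|b| <= A ->
    `|f (a, b) - F * (a * b)| <= M * (`|a| * `|b| * (a ^+ 2 + b ^+ 2))) ->
  tame A B2 B4 B6 x -> tame A B2 B4 B6 y ->
  let r i := f (tnth x i : R, tnth y i : R) in
  `|\sum_i r i - F * inner x y| <= M * (B6 ^+ 6 + B2 ^+ 2) /\
  \sum_i r i ^+ 2 <=
    2 * F ^+ 2 * B4 ^+ 4 + 2 * (M * (B6 ^+ 6 + B2 ^+ 2)) ^+ 2.
Proof.
move=> B20 B40 B60 M0 N0 fE tx ty r.
have [xA x2 x4 x6] := tame_moments B20 B40 B60 N0 tx.
have [yA y2 y4 y6] := tame_moments B20 B40 B60 N0 ty.
pose X i := (tnth x i : R); pose Y i := (tnth y i : R).
pose d i := `|X i| * `|Y i| * (X i ^+ 2 + Y i ^+ 2).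
have d0 i : 0 <= d i by rewrite !mulr_ge0// addr_ge0 ?sqr_ge0.
have dB : \sum_i d i <= B6 ^+ 6 + B2 ^+ 2.
  have := sum_cube_mul_le N0 x6 y2; have := sum_cube_mul_le N0 y6 x2.
  have -> : \sum_i d i = \sum_i `|X i| ^+ 3 * `|Y i| + \sum_i `|Y i| ^+ 3 * `|X i|.
    rewrite -big_split /=; apply: eq_bigr => i _; rewrite /d.
    by rewrite -(real_normK (num_real (X i))) -(real_normK (num_real (Y i))); ring.
  by rewrite /X /Y; lra.
have rd i : `|r i - F * (X i * Y i)| <= M * d i by apply: fE.
have dM0 : 0 <= \sum_i d i by apply: sumr_ge0.
split.
  rewrite /inner mulr_sumr -sumrB.
  apply: (le_trans (ler_norm_sum _ _ _)).
  apply: (@le_trans _ _ (\sum_i M * d i)); first by apply: ler_sum => i _; exact: rd.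
  by rewrite -mulr_sumr ler_wpM2l.
apply: (@le_trans _ _ (\sum_i (F ^+ 2 * (X i ^+ 4 + Y i ^+ 4) +
    2 * M ^+ 2 * (d i * \sum_j d j)))).
  apply: ler_sum => i _.
  have h1 : (r i - F * (X i * Y i)) ^+ 2 <= M ^+ 2 * (d i * \sum_j d j).
    rewrite -(real_normK (num_real (r i - _))).
    apply: (@le_trans _ _ ((M * d i) ^+ 2)).
      by apply: lerXn2r (rd i); rewrite nnegrE ?normr_ge0 ?(mulr_ge0 M0).
    rewrite exprMn ler_wpM2l ?sqr_ge0// expr2 ler_wpM2l//.
    by rewrite (bigD1 i)//= lerDl sumr_ge0.
  have h2 : 2 * (X i ^+ 2 * Y i ^+ 2) <= X i ^+ 4 + Y i ^+ 4.
    have := sqr_ge0 (X i ^+ 2 - Y i ^+ 2); rewrite sqrrB -!exprM; lra.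
  have h3 : F ^+ 2 * (2 * (X i ^+ 2 * Y i ^+ 2)) <= F ^+ 2 * (X i ^+ 4 + Y i ^+ 4).
    by rewrite ler_wpM2l ?sqr_ge0.
  have -> : r i = (r i - F * (X i * Y i)) + F * (X i * Y i) by rewrite subrK.
  move: (r i - _) h1 => u h1.
  have := sqr_ge0 (u - F * (X i * Y i)); rewrite sqrrB sqrrD !exprMn; lra.
rewrite big_split /= -!mulr_sumr -mulr_suml big_split /=.
have e4 z : z ^+ 4 = `|z| ^+ 4 :> R.
  by rewrite -normrX ger0_norm// exprn_even_ge0.
under eq_bigr do rewrite e4; under [X in _ * (_ + X) + _]eq_bigr do rewrite e4.
apply: lerD.
  rewrite [2 * _]mulrC -[leRHS]mulrA ler_wpM2l ?sqr_ge0//.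
  by have := lerD x4 y4; rewrite /X /Y; lra.
rewrite exprMn [leRHS]mulrA ler_wpM2l ?mulr_ge0 ?sqr_ge0//.
by rewrite expr2 ler_pM.
Qed.

End PriorMoments.

(** * Integration against product laws *)
Section TupleLaw.
Context d (T : measurableType d) (R : realType).
Local Open Scope ereal_scope.
Implicit Types n : nat.

Lemma measurable_tuple_consT n :
  measurable_fun [set: T * n.-tuple T] (@tuple_cons _ T n).
Proof. by apply: measurable_cons => /=. Qed.

Lemma measurable_cons_section n d' (Y : measurableType d')
    (h : n.+1.-tuple T -> Y) : measurable_fun [set: n.+1.-tuple T] h ->
  measurable_fun [set: T * n.-tuple T] (fun z => h (tuple_cons z)).
Proof. by move=> mh; apply: measurableT_comp => //; exact: measurable_tuple_consT. Qed.

Lemma ge0_integral_tupleS n (p : 'I_n.+1 -> probability T R)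
    (h : n.+1.-tuple T -> \bar R) :
  measurable_fun [set: n.+1.-tuple T] h -> (forall y, 0 <= h y) ->
  \int[tuple_law p]_y h y =
  \int[p ord0]_a \int[tuple_law (fun i => p (lift ord0 i))]_y h (tuple_cons (a, y)).
Proof.
move=> mh h0.
have := @ge0_integral_pushforward _ _ _ _ R _ (@measurable_tuple_consT n)
  (p ord0 \x tuple_law (fun i => p (lift ord0 i))) setT h measurableT mh.
rewrite preimage_setT => H.
transitivity (\int[p ord0 \x tuple_law (fun i => p (lift ord0 i))]_x (h \o (@tuple_cons _ T n)) x).
  by rewrite -H// => y _.
by rewrite fubini_tonelli1//; [exact: measurable_cons_section|move=> x /=].
Qed.

Lemma integral_tuple0 (p : 'I_0 -> probability T R) (h : 0.-tuple T -> \bar R) :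
  measurable_fun [set: 0.-tuple T] h ->
  \int[tuple_law p]_y h y = h [tuple].
Proof.
move=> mh.
transitivity (\int[\d_([tuple] : 0.-tuple T)]_y h y); first by [].
by rewrite integral_dirac// diracT mul1e.
Qed.

Lemma integrable_tupleS n (p : 'I_n.+1 -> probability T R)
    (h : n.+1.-tuple T -> \bar R) : (tuple_law p).-integrable setT h ->
  (p ord0 \x tuple_law (fun i => p (lift ord0 i))).-integrable setT
    (fun z => h (tuple_cons z)).
Proof.
move=> /integrableP[mh hoo]; apply/integrableP; split.
  exact: measurable_cons_section.
rewrite fubini_tonelli1//=; last first.
  by apply: measurableT_comp => //; exact: measurable_cons_section.
rewrite /fubini_F/= -(@ge0_integral_tupleS _ _ (fun y => `|h y|)) //.
exact: measurableT_comp.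
Qed.

Lemma integral_tupleS n (p : 'I_n.+1 -> probability T R)
    (h : n.+1.-tuple T -> \bar R) : (tuple_law p).-integrable setT h ->
  \int[tuple_law p]_y h y =
  \int[p ord0]_a \int[tuple_law (fun i => p (lift ord0 i))]_y h (tuple_cons (a, y)).
Proof.
move=> ih; have ih' := integrable_tupleS ih.
rewrite [RHS](integral12_prod_meas1 ih').
have := @integral_pushforward _ _ _ _ R _ (@measurable_tuple_consT n)
  (p ord0 \x tuple_law (fun i => p (lift ord0 i))) setT h (measurable_int _ ih).
by rewrite preimage_setT; apply.
Qed.

End TupleLaw.

Section TupleLawIntegrals.
Context d (T : measurableType d) (R : realType).
Local Open Scope ereal_scope.
Implicit Types n : nat.

Lemma tnth_tuple_cons0 n (a : T) (y : n.-tuple T) : tnth (tuple_cons (a, y)) ord0 = a.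
Proof. by []. Qed.

Lemma tnth_tuple_consS n (a : T) (y : n.-tuple T) j :
  tnth (tuple_cons (a, y)) (lift ord0 j) = tnth y j.
Proof. by rewrite /tuple_cons tnthS. Qed.

Lemma prod_tuple_cons n (f : 'I_n.+1 -> T -> R) (a : T) (y : n.-tuple T) :
  (\prod_i f i (tnth (tuple_cons (a, y)) i) =
  f ord0 a * \prod_i f (lift ord0 i) (tnth y i))%R.
Proof.
rewrite big_ord_recl tnth_tuple_cons0; congr (_ * _)%R.
by apply: eq_bigr => i _; rewrite tnth_tuple_consS.
Qed.

Lemma measurable_tuple_prod n (f : 'I_n -> T -> R) :
  (forall i, measurable_fun setT (f i)) ->
  measurable_fun [set: n.-tuple T] (fun y => \prod_i f i (tnth y i))%R.
Proof.
move=> mf; apply: measurable_prod => i _.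
exact: (measurableT_comp (mf i) (measurable_tnth i)).
Qed.

Lemma ge0_integral_tuple_prod n (p : 'I_n -> probability T R) (f : 'I_n -> T -> R) :
  (forall i, measurable_fun setT (f i)) -> (forall i y, 0 <= f i y)%R ->
  \int[tuple_law p]_y (\prod_i f i (tnth y i))%:E =
  \prod_i \int[p i]_y (f i y)%:E.
Proof.
elim: n p f => [|n IH] p f mf f0.
  rewrite integral_tuple0 ?big_ord0//.
  by apply/measurable_EFinP; apply: measurable_tuple_prod.
rewrite ge0_integral_tupleS; last 2 first.
- by apply/measurable_EFinP; apply: measurable_tuple_prod.
- by move=> y; rewrite lee_fin prodr_ge0.
rewrite big_ord_recl -IH//.
set c := \int[_]_y (\prod_(i < n) f (lift ord0 i) (tnth y i))%:E.
have c0 : 0 <= c by apply: integral_ge0 => y _; rewrite lee_fin prodr_ge0.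
under eq_integral => a _.
  under eq_integral do rewrite prod_tuple_cons EFinM.
  rewrite ge0_integralZl//; last 3 first.
  - by apply/measurable_EFinP; apply: (@measurable_tuple_prod n (fun i => f (lift ord0 i))).
  - by move=> y _; rewrite lee_fin prodr_ge0.
  - by rewrite lee_fin.
  rewrite -/c; over.
rewrite ge0_integralZr//; first exact/measurable_EFinP.
by move=> a _; rewrite lee_fin.
Qed.

Lemma integrable_tuple_prod n (p : 'I_n -> probability T R) (f : 'I_n -> T -> R) :
  (forall i, (p i).-integrable setT (EFin \o f i)) ->
  (tuple_law p).-integrable setT (fun y => (\prod_i f i (tnth y i))%:E).
Proof.
move=> fi; have mf i : measurable_fun setT (f i).
  exact/measurable_EFinP/(measurable_int _ (fi i)).
apply/integrableP; split; first by apply/measurable_EFinP; apply: measurable_tuple_prod.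
under eq_integral do rewrite abse_EFin normr_prod.
rewrite (@ge0_integral_tuple_prod _ _ (fun i y => `|f i y|%R))//; last first.
  by move=> i; exact: measurableT_comp.
rewrite ltey_eq; apply/orP; left.
apply: (@big_ind _ (fun x => x \is a fin_num)) => //.
  by move=> x y; exact: fin_numM.
move=> i _; have := integrable_fin_num measurableT (integrable_norm (fi i)).
by under eq_integral do rewrite /= .
Qed.

Lemma integral_tuple_prod n (p : 'I_n -> probability T R) (f : 'I_n -> T -> R) :
  (forall i, (p i).-integrable setT (EFin \o f i)) ->
  \int[tuple_law p]_y (\prod_i f i (tnth y i))%:E =
  (\prod_i \int[p i]_y f i y)%R%:E.
Proof.
elim: n p f => [|n IH] p f fi.
  rewrite integral_tuple0 ?big_ord0//.
  by apply/measurable_EFinP; apply: measurable_tuple_prod; case.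
rewrite integral_tupleS; last exact: integrable_tuple_prod.
rewrite big_ord_recl.
under eq_integral => a _.
  under eq_integral do rewrite prod_tuple_cons EFinM.
  rewrite integralZl//; last first.
    by apply: (@integrable_tuple_prod n _ (fun i => f (lift ord0 i))) => i; exact: fi.
  rewrite (IH _ (fun i => f (lift ord0 i))); last by move=> i; exact: fi.
  over.
rewrite integralZr//; last exact: fi.
rewrite EFinM; congr (_ * _).
by rewrite /Rintegral fineK//; apply: integrable_fin_num => //; exact: fi.
Qed.

(** Stated with nonnegative functions so that Tonelli's theorem applies without
    integrability of [h] times the density. *)
Lemma ge0_integral_tuple_density n (p q : 'I_n -> probability T R)
    (L : 'I_n -> T -> R) (h : n.-tuple T -> \bar R) :
  (forall i, measurable_fun setT (L i)) -> (forall i y, 0 <= L i y)%R ->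
  (forall i f, measurable_fun setT f -> (forall y, 0 <= f y) ->
    \int[q i]_y f y = \int[p i]_y (f y * (L i y)%:E)) ->
  measurable_fun setT h -> (forall y, 0 <= h y) ->
  \int[tuple_law q]_y h y =
  \int[tuple_law p]_y (h y * (\prod_i L i (tnth y i))%:E).
Proof.
elim: n p q L h => [|n IH] p q L h mL L0 pq mh h0.
  rewrite !integral_tuple0 ?big_ord0 ?mule1//.
  apply: emeasurable_funM => //.
  by apply/measurable_EFinP; apply: measurable_tuple_prod; case.
have mhL : measurable_fun setT (fun y => h y * (\prod_i L i (tnth y i))%:E).
  by apply: emeasurable_funM => //; apply/measurable_EFinP; apply: measurable_tuple_prod.
have hL0 y : 0 <= h y * (\prod_i L i (tnth y i))%:E.
  by rewrite mule_ge0// lee_fin prodr_ge0.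
rewrite !ge0_integral_tupleS//.
pose h1 (z : T * n.-tuple T) :=
  h (tuple_cons z) * (\prod_i L (lift ord0 i) (tnth z.2 i))%:E.
have h10 z : 0 <= h1 z by rewrite mule_ge0// lee_fin prodr_ge0.
have mh1 : measurable_fun setT h1.
  apply: emeasurable_funM; first exact: measurable_cons_section.
  apply/measurable_EFinP.
  apply: (measurableT_comp (@measurable_tuple_prod n (fun i => L (lift ord0 i)) _)) => //.
transitivity (\int[q ord0]_a fubini_F (tuple_law (fun i => p (lift ord0 i))) h1 a).
  apply: eq_integral => a _; rewrite (IH (fun i => p (lift ord0 i)) _
    (fun i => L (lift ord0 i)))//.
    by move=> i f; exact: pq.
  apply: (@measurableT_comp _ _ _ _ _ _ (fun z => h (tuple_cons z)) _ (pair a)).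
    exact: measurable_cons_section.
  exact: measurable_pair1.
transitivity (\int[p ord0]_a
    (fubini_F (tuple_law (fun i => p (lift ord0 i))) h1 a * (L ord0 a)%:E)).
  apply: pq; first exact: measurable_fun_fubini_tonelli_F.
  by move=> a; apply: integral_ge0 => y _.
apply: eq_integral => a _; rewrite /fubini_F -ge0_integralZr//; last 2 first.
- exact: (measurableT_comp mh1 (@measurable_pair1 _ _ _ _ a)).
- by rewrite lee_fin.
apply: eq_integral => y _; rewrite prod_tuple_cons /h1 /= -muleA -EFinM.
by rewrite mulrC.
Qed.

Definition tuple_upd n (i : 'I_n) (w : T) (y : n.-tuple T) : n.-tuple T :=
  [tuple if j == i then w else tnth y j | j < n].

Lemma tuple_upd_cons0 n (w a : T) (y : n.-tuple T) :
  tuple_upd ord0 w (tuple_cons (a, y)) = tuple_cons (w, y).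
Proof.
apply: eq_from_tnth => i; rewrite tnth_mktuple.
by case: (unliftP ord0 i) => [j ->|->]; rewrite ?tnth_tuple_consS.
Qed.

Lemma tuple_upd_consS n (w a : T) (y : n.-tuple T) (j : 'I_n) :
  tuple_upd (lift ord0 j) w (tuple_cons (a, y)) = tuple_cons (a, tuple_upd j w y).
Proof.
apply: eq_from_tnth => i; rewrite tnth_mktuple.
case: (unliftP ord0 i) => [k ->|-> //].
by rewrite !tnth_tuple_consS tnth_mktuple (inj_eq lift_inj).
Qed.

(** Integrating the coordinate [i] first gives [0]; since [tuple_law] is built from
    the head, coordinate [i] is reached by induction. *)
Lemma integral_tuple_coord_eq0 n (p : 'I_n -> probability T R) (i : 'I_n)
    (h : n.-tuple T -> \bar R) : (tuple_law p).-integrable setT h ->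
  (forall y, \int[p i]_w h (tuple_upd i w y) = 0) ->
  \int[tuple_law p]_y h y = 0.
Proof.
elim: n p i h => [p []//|n IH] p i h ih h0.
have ih' := integrable_tupleS ih.
rewrite integral_tupleS//.
case: (unliftP ord0 i) h0 => [j ->|->] h0.
  rewrite (ae_eq_integral (cst 0))// ?integral0//.
    by case/integrableP: (integrable_fubini_F ih').
  have := ae_integrable1 ih'; apply: filterS => a ia _ /=.
  by apply: (IH _ j) => // y; under eq_integral do rewrite -tuple_upd_consS.
rewrite (Fubini ih'); apply: integral0_eq => y _.
have [[a _]|T0] := pselect (exists a : T, True).
  by under eq_integral do rewrite -(tuple_upd_cons0 _ a).
by apply: integral0_eq => a _; case: T0; exists a.
Qed.

End TupleLawIntegrals.

(** * Finite samples of a bounded kernel *)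
Section BoundedIntegrals.
Context d (T : measurableType d) (R : realType) (X : probability T R).
Implicit Types (g f : T -> R).

Lemma bounded_integrable g (M : R) : measurable_fun setT g ->
  (forall x, `|g x| <= M) -> X.-integrable setT (EFin \o g).
Proof.
move=> mg gM; apply: (@le_integrable _ _ _ X setT measurableT _ (cst M%:E)).
- exact/measurable_EFinP.
- move=> x _ /=; rewrite lee_fin; apply: (le_trans (gM x)); exact: ler_norm.
- apply/integrableP; split => //.
  rewrite integral_cst//= probability_setT mule1; exact: ltry.
Qed.

(** Otherwise [g] minus its mean is positive everywhere with integral [0]. *)
Lemma exists_le_mean g (M : R) : measurable_fun setT g ->
  (forall x, `|g x| <= M) -> exists x, g x <= \int[X]_x g x.
Proof.
move=> mg gM; have ig := bounded_integrable mg gM.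
apply: contrapT => /forallNP gx.
set m := \int[X]_x g x in gx.
have {}gx x : m < g x by rewrite ltNge; apply/negP/gx.
have icst : X.-integrable setT (EFin \o (fun=> m)).
  by apply: (@bounded_integrable _ `|m|) => //; exact: measurable_cst.
have Z : (\int[X]_x `|(g x - m)%:E| = 0)%E.
  transitivity (\int[X]_x ((g x)%:E - m%:E))%E.
    by apply: eq_integral => x _; rewrite abse_EFin ger0_norm ?EFinB// subr_ge0 ltW.
  rewrite integralB_EFin//.
  rewrite integral_cst// [X in (_ * X)%E]probability_setT mule1.
  by rewrite /m /Rintegral fineK ?subee//; exact: integrable_fin_num.
have mgm : measurable_fun setT (fun x => (g x - m)%:E).
  by apply/measurable_EFinP; exact: measurable_funB.
have [N [mN N0 sN]] := (ae_eq_integral_abs X measurableT mgm).1 Z.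
have NT : N = setT.
  rewrite -subTset => x _; apply: sN => /= /(_ I) [] /eqP.
  by rewrite subr_eq0 gt_eqF.
by have := probability_setT X; rewrite -NT N0 => /eqP; rewrite eq_sym onee_eq0.
Qed.

End BoundedIntegrals.

Lemma product_setT d (T : measurableType d) (R : realType) (X : probability T R) :
  (X \x X)%E setT = 1%E.
Proof.
rewrite -setXTT product_measure1E// -[RHS]mule1.
by congr (_ * _)%E; exact: probability_setT.
Qed.

Section Sampling.
Context d (T : measurableType d) (R : realType) (X : probability T R).
Variables (H : T * T -> R) (M : R).
Hypotheses (mH : measurable_fun setT H) (HM : forall z, `|H z| <= M).
Hypothesis Hsym : forall x y, H (x, y) = H (y, x).

Definition kernel_mean (y : T) : R := \int[X]_x H (x, y).
Definition kernel_total : R := \int[X]_y kernel_mean y.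

Let M0 : 0 <= M.
Proof.
have [x _] : exists x : T, True.
  apply: contrapT => /forallNP T0.
  have := probability_setT X; rewrite (_ : setT = set0) ?measure0.
    by move=> /eqP; rewrite eq_sym onee_eq0.
  by apply/seteqP; split => x // _; case: (T0 x).
exact: le_trans (HM (x, x)).
Qed.

Lemma measurable_kernel_section y : measurable_fun setT (fun x => H (x, y)).
Proof. exact: (measurableT_comp mH (@measurable_pair2 _ _ _ _ y)). Qed.

Lemma kernel_integrable : (X \x X)%E.-integrable setT (EFin \o H).
Proof.
apply: (@le_integrable _ _ _ (X \x X)%E setT measurableT _ (cst M%:E)).
- exact/measurable_EFinP.
- move=> x _ /=; rewrite lee_fin; apply: (le_trans (HM x)); exact: ler_norm.
- apply/integrableP; split => //.
  rewrite integral_cst//= product_setT mule1.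
  exact: ltry.
Qed.

Lemma kernel_meanE y : (kernel_mean y)%:E = (\int[X]_x (H (x, y))%:E)%E.
Proof.
rewrite /kernel_mean /Rintegral fineK//; apply: integrable_fin_num => //.
by apply: (@bounded_integrable _ _ _ _ _ M) => //; exact: measurable_kernel_section.
Qed.

Lemma measurable_kernel_mean : measurable_fun setT kernel_mean.
Proof.
apply/measurable_EFinP.
apply: (@eq_measurable_fun _ _ _ _ setT
   (fubini_F X (fun z : T * T => (H (z.2, z.1))%:E))).
  by move=> y _; rewrite /= kernel_meanE.
apply: (@measurable_int _ _ _ X); apply: integrable_fubini_F.
apply: (@le_integrable _ _ _ (X \x X)%E setT measurableT _ (cst M%:E)).
- apply/measurable_EFinP.
  by apply: (measurableT_comp mH); exact: measurable_swap.
- move=> x _ /=; rewrite lee_fin; apply: (le_trans (HM _)); exact: ler_norm.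
- apply/integrableP; split => //.
  rewrite integral_cst//= product_setT mule1.
  exact: ltry.
Qed.

Lemma kernel_mean_le y : `|kernel_mean y| <= M.
Proof.
apply: le_trans (le_normr_Rintegral _ _) _ => //.
  by apply: (@bounded_integrable _ _ _ _ _ M) => //; exact: measurable_kernel_section.
have -> : M = \int[X]_(x in setT) M.
  rewrite Rintegral_cst// [Z in fine Z](_ : _ = 1%E) ?mulr1//.
  exact: probability_setT.
apply: le_Rintegral => //.
- apply: (@bounded_integrable _ _ _ _ _ M) => [|x]; last by rewrite normr_id.
  by apply: measurableT_comp => //; exact: measurable_kernel_section.
- by apply: (@bounded_integrable _ _ _ _ _ `|M|) => //; exact: measurable_cst.
Qed.

Lemma kernel_total_le : `|kernel_total| <= M.
Proof.
have ik := bounded_integrable X measurable_kernel_mean kernel_mean_le.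
apply: le_trans (le_normr_Rintegral _ _) _ => //.
have -> : M = \int[X]_(x in setT) M.
  rewrite Rintegral_cst// [Z in fine Z](_ : _ = 1%E) ?mulr1//.
  exact: probability_setT.
apply: le_Rintegral => //.
- apply: (@bounded_integrable _ _ _ _ _ M) => [|x]; last by rewrite normr_id kernel_mean_le.
  by apply: measurableT_comp => //; exact: measurable_kernel_mean.
- by apply: (@bounded_integrable _ _ _ _ _ `|M|) => //; exact: measurable_cst.
- by move=> x _; exact: kernel_mean_le.
Qed.

Definition gram_sum (s : seq T) : R := \sum_(x <- s) \sum_(y <- s) H (x, y).

Lemma gram_sum_cons x s :
  gram_sum (x :: s) = gram_sum s + 2 * (\sum_(y <- s) H (x, y)) + H (x, x).
Proof.
rewrite /gram_sum big_cons big_cons.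
under [X in _ + X = _]eq_bigr do rewrite big_cons.
rewrite big_split /=.
have -> : \sum_(y <- s) H (y, x) = \sum_(y <- s) H (x, y).
  by apply: eq_bigr => y _; rewrite Hsym.
by ring.
Qed.

(** A bound on the conditional expectation of the Gram sum when [r] more independent
    points are to be drawn; the last term accounts for the diagonal. *)
Let potential r (s : seq T) : R :=
  gram_sum s + 2 * r%:R * (\sum_(y <- s) kernel_mean y) +
  r%:R ^+ 2 * kernel_total + 2 * r%:R * M.

Let potential_step r s : exists x, potential r (x :: s) <= potential r.+1 s.
Proof.
pose g x := 2 * (\sum_(y <- s) H (x, y)) + 2 * r%:R * kernel_mean x.
have msum (u : seq T) : measurable_fun setT (fun x => \sum_(y <- u) H (x, y)).
  by apply: measurable_sum => y; exact: measurable_kernel_section.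
have mg : measurable_fun setT g.
  apply: measurable_funD; apply: measurable_funM => //.
  exact: measurable_kernel_mean.
have sM (u : seq T) x : `|\sum_(y <- u) H (x, y)| <= (size u)%:R * M.
  elim: u => [|y u IH]; first by rewrite big_nil normr0 mul0r.
  rewrite big_cons /= -natr1 mulrDl mul1r addrC.
  by apply: (le_trans (ler_normD _ _)); rewrite lerD.
have gM x : `|g x| <= 2 * ((size s)%:R * M) + 2 * r%:R * M.
  apply: (le_trans (ler_normD _ _)); apply: lerD.
    by rewrite normrM ger0_norm// ler_wpM2l.
  by rewrite normrM ger0_norm ?mulr_ge0// ler_wpM2l ?mulr_ge0// kernel_mean_le.
have [x gx] := exists_le_mean X mg gM; exists x.
have isum (u : seq T) :
    X.-integrable setT (EFin \o (fun x => \sum_(y <- u) H (x, y))).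
  exact: (bounded_integrable X (msum u) (sM u)).
have sumE (u : seq T) : \int[X]_x (\sum_(y <- u) H (x, y)) =
    \sum_(y <- u) kernel_mean y.
  elim: u => [|y u IH].
    rewrite big_nil; under eq_Rintegral do rewrite big_nil.
    by rewrite Rintegral_cst// mul0r.
  rewrite big_cons; under eq_Rintegral do rewrite big_cons.
  rewrite RintegralD ?IH//.
  apply: (@bounded_integrable _ _ _ _ _ M) => //; exact: measurable_kernel_section.
have ik := bounded_integrable X measurable_kernel_mean kernel_mean_le.
have gE : \int[X]_x g x =
    2 * (\sum_(y <- s) kernel_mean y) + 2 * r%:R * kernel_total.
  rewrite /g RintegralD//.
  - by rewrite !RintegralZl// ?sumE//; exact: isum.
  - apply: (@bounded_integrable _ _ _ _ _ (2 * ((size s)%:R * M))) => [|z].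
      exact: measurable_funM.
    by rewrite normrM ger0_norm// ler_wpM2l.
  - apply: (@bounded_integrable _ _ _ _ _ (2 * r%:R * M)) => [|z].
      by apply: measurable_funM => //; exact: measurable_kernel_mean.
    by rewrite normrM ger0_norm ?mulr_ge0// ler_wpM2l ?mulr_ge0// kernel_mean_le.
move: gx; rewrite gE /g /potential gram_sum_cons big_cons -natr1.
have := HM (x, x); rewrite ler_norml => /andP[_ hxx].
have := kernel_total_le; rewrite ler_norml => /andP[hk _].
by nra.
Qed.

(** The method of conditional expectations: each point is chosen so that the
    potential does not increase.  This gives the bound on the mean Gram sum of
    independent samples without product measures over the samples. *)
Lemma exists_gram_sum_le n : exists2 s : seq T, size s = n &
  gram_sum s <= n%:R ^+ 2 * kernel_total + 2 * n%:R * M.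
Proof.
suff H1 k : (k <= n)%N -> exists2 s : seq T, size s = k &
    potential (n - k) s <= potential n [::].
  have [s ss] := H1 n (leqnn n); rewrite subnn /potential => hs.
  exists s => //; move: hs; rewrite /gram_sum !big_nil; lra.
elim: k => [|k IH] kn; first by exists [::]; rewrite ?subn0.
have [s ss hs] := IH (ltnW kn).
have [x hx] := potential_step (n - k.+1) s.
exists (x :: s); first by rewrite /= ss.
by apply: (le_trans hx); rewrite subnSK.
Qed.

End Sampling.

(** * Square-integrable functions *)
Section SquareIntegrable.
Context d (T : measurableType d) (R : realType) (mu : probability T R).
Implicit Types f g : T -> R.

(** Membership in the space [Lfun mu 2%:E] (see [sqintP]), in a form
    that unfolds to measurability and integrability. *)
Definition sqint f := measurable_fun setT f /\
  mu.-integrable setT (EFin \o (fun x => f x ^+ 2)).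

Lemma sqintP f : f \in Lfun mu 2%:E <-> sqint f.
Proof.
split=> [Lf|[mf f2]].
  split; last exact: Lfun2_integrable_sqr.
  by move: Lf; rewrite inE => /andP[/[!inE]].
rewrite inE; apply/andP; rewrite !inE /=; split => //.
rewrite /finite_norm unlock /= poweR_lty//.
have /integrableP[_] := f2; apply: le_lt_trans.
rewrite le_eqVlt; apply/orP; left; apply/eqP; apply: eq_integral => x _ /=.
by rewrite powR_mulrn// -normrX.
Qed.

Lemma integrable_le f g : measurable_fun setT f -> mu.-integrable setT (EFin \o g) ->
  (forall x, `|f x| <= g x) -> mu.-integrable setT (EFin \o f).
Proof.
move=> mf ig fg; apply: (le_integrable measurableT _ _ ig); first exact/measurable_EFinP.
by move=> x _ /=; rewrite lee_fin; apply: (le_trans (fg x)); exact: ler_norm.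
Qed.

Lemma integrableDR f g : mu.-integrable setT (EFin \o f) ->
  mu.-integrable setT (EFin \o g) ->
  mu.-integrable setT (EFin \o (fun x => f x + g x)).
Proof. by move=> hf hg; exact: (integrableD measurableT hf hg). Qed.

Lemma integrableZR f (r : R) : mu.-integrable setT (EFin \o f) ->
  mu.-integrable setT (EFin \o (fun x => r * f x)).
Proof. by move=> hf; exact: (integrableZl measurableT r hf). Qed.

Lemma sqintM f g : sqint f -> sqint g ->
  mu.-integrable setT (EFin \o (fun x => f x * g x)).
Proof.
move=> [mf f2] [mg g2].
apply: (integrable_le _ (integrableDR f2 g2)); first exact: measurable_funM.
move=> x; rewrite ler_norml; have := sqr_ge0 (f x + g x); have := sqr_ge0 (f x - g x).
by rewrite sqrrB sqrrD; have := sqr_ge0 (f x); have := sqr_ge0 (g x); lra.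
Qed.

Lemma sqint_cst c : sqint (fun=> c).
Proof.
split; first exact: measurable_cst.
apply/integrableP; split; first exact/measurable_EFinP/measurable_cst.
rewrite integral_cst//= (_ : mu setT = 1%E) ?mule1 ?ltry//.
exact: probability_setT.
Qed.

Lemma sqint_integrable f : sqint f -> mu.-integrable setT (EFin \o f).
Proof.
move=> hf; have := sqintM hf (sqint_cst 1).
by congr (mu.-integrable _ _); apply/funext => x /=; rewrite mulr1.
Qed.

Lemma sqintD f g : sqint f -> sqint g -> sqint (fun x => f x + g x).
Proof.
move=> hf hg; have [mf f2] := hf; have [mg g2] := hg.
split; first exact: measurable_funD.
have := integrableDR (integrableDR f2 g2) (integrableZR 2 (sqintM hf hg)).
by congr (mu.-integrable _ _); apply/funext => x /=; congr EFin; ring.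
Qed.

Lemma sqintZ (r : R) f : sqint f -> sqint (fun x => r * f x).
Proof.
move=> [mf f2]; split; first exact: measurable_funM.
have := integrableZR (r ^+ 2) f2.
by congr (mu.-integrable _ _); apply/funext => x /=; congr EFin; ring.
Qed.

Lemma sqint_sum (I : Type) (s : seq I) (P : pred I) (F : I -> T -> R) :
  (forall i, P i -> sqint (F i)) -> sqint (fun x => \sum_(i <- s | P i) F i x).
Proof.
move=> hF; elim: s => [|i s IH].
  by under eq_fun do rewrite big_nil; exact: sqint_cst.
case Pi : (P i); under eq_fun do rewrite big_cons Pi; last by [].
by apply: sqintD => //; exact: hF.
Qed.

Definition inprod f g : R := \int[mu]_x (f x * g x).

Lemma inprodC f g : inprod f g = inprod g f.
Proof. by apply: eq_Rintegral => x _; rewrite mulrC. Qed.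

Lemma inprod_suml (I : Type) (s : seq I) (P : pred I) (F : I -> T -> R) g :
  (forall i, P i -> sqint (F i)) -> sqint g ->
  inprod (fun x => \sum_(i <- s | P i) F i x) g =
  \sum_(i <- s | P i) inprod (F i) g.
Proof.
move=> hF hg; elim: s => [|i s IH].
  rewrite big_nil /inprod; under eq_Rintegral do rewrite big_nil mul0r.
  by rewrite Rintegral_cst// mul0r.
rewrite big_cons -IH /inprod; case Pi : (P i).
  under eq_Rintegral do rewrite big_cons Pi mulrDl.
  rewrite RintegralD//; first exact: sqintM (hF _ Pi) hg.
  by apply: sqintM => //; exact: sqint_sum.
by apply: eq_Rintegral => x _; rewrite big_cons Pi.
Qed.

Lemma inprod_sumr (I : Type) (s : seq I) (P : pred I) (F : I -> T -> R) g :
  (forall i, P i -> sqint (F i)) -> sqint g ->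
  inprod g (fun x => \sum_(i <- s | P i) F i x) =
  \sum_(i <- s | P i) inprod g (F i).
Proof.
move=> hF hg; rewrite inprodC inprod_suml//.
by apply: eq_bigr => i _; rewrite inprodC.
Qed.

Lemma inprodZl (r : R) f g : sqint f -> sqint g ->
  inprod (fun x => r * f x) g = r * inprod f g.
Proof.
move=> hf hg; rewrite /inprod -RintegralZl//; last exact: sqintM.
by apply: eq_Rintegral => x _; rewrite mulrA.
Qed.

Lemma inprod_ge0 f : 0 <= inprod f f.
Proof. by apply: Rintegral_ge0 => x _; rewrite -expr2 sqr_ge0. Qed.

(** Expand the squared norm of [g - <f, g> f]. *)
Lemma cauchy_schwarz f g : sqint f -> sqint g -> inprod f f <= 1 ->
  inprod f g ^+ 2 <= inprod g g.
Proof.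
move=> hf hg f1; set l := inprod f g.
have hlf := sqintZ (- l) hf.
have : 0 <= inprod (fun x => g x + - l * f x) (fun x => g x + - l * f x).
  exact: inprod_ge0.
have -> : inprod (fun x => g x + - l * f x) (fun x => g x + - l * f x) =
    inprod g g - 2 * l ^+ 2 + l ^+ 2 * inprod f f.
  have -> : inprod (fun x => g x + - l * f x) (fun x => g x + - l * f x) =
     \int[mu]_x ((g x * g x) + ((- 2 * l) * (f x * g x) + l ^+ 2 * (f x * f x))).
    by apply: eq_Rintegral => x _; ring.
  have i1 := sqintM hg hg; have i2 := integrableZR (- 2 * l) (sqintM hf hg).
  have i3 := integrableZR (l ^+ 2) (sqintM hf hf).
  rewrite RintegralD//; last exact: integrableDR.
  rewrite RintegralD// RintegralZl//; last exact: sqintM.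
  rewrite RintegralZl//; last exact: sqintM.
  rewrite -/(inprod g g) -/(inprod f g) -/(inprod f f) -/l; ring.
have := sqr_ge0 l; nra.
Qed.

End SquareIntegrable.

(** * Densities and overlaps of the channel *)
Section Density.
Context d (Omega : measurableType d) (R : realType) (S : alphabet R).
Variable P : R.-pker letter S ~> Omega.
Hypothesis goodP : good_channel P.
Implicit Types a b : letter S.

Local Notation P0 := (channel0 P).

Let abs_cont a : law P a `<< P0. Proof. by case: goodP => _ /(_ a)[]. Qed.

(** The likelihood ratio is nonnegative only almost everywhere; this version of it
    is nonnegative everywhere, hence usable in nonnegative integrals. *)
Definition density a (y : Omega) : R :=
  fine (Radon_Nikodym_SigmaFinite.f (law P a) P0 y).

Lemma density_ge0 a y : 0 <= density a y.
Proof.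
by apply: fine_ge0; apply: Radon_Nikodym_SigmaFinite.f_ge0; exact: abs_cont.
Qed.

Lemma EFin_density a y :
  (density a y)%:E = Radon_Nikodym_SigmaFinite.f (law P a) P0 y.
Proof.
rewrite fineK//; apply: Radon_Nikodym_SigmaFinite.f_fin_num; exact: abs_cont.
Qed.

Lemma measurable_density a : measurable_fun setT (density a).
Proof.
apply/measurable_EFinP.
rewrite (_ : EFin \o _ = Radon_Nikodym_SigmaFinite.f (law P a) P0).
  exact: measurable_int (Radon_Nikodym_SigmaFinite.f_integrable (abs_cont a)).
by apply/funext => y /=; rewrite EFin_density.
Qed.

Lemma integral_law a f : measurable_fun setT f -> (forall y, 0 <= f y)%E ->
  (\int[law P a]_y f y = \int[P0]_y (f y * (density a y)%:E))%E.
Proof.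
move=> mf f0.
have <- := Radon_Nikodym_SigmaFinite.change_of_variables (abs_cont a) f0 measurableT mf.
by apply: eq_integral => y _; rewrite EFin_density.
Qed.

Lemma ae_density a : ae_eq P0 setT (density a) (likelihood_ratio P a).
Proof.
have := ae_eq_Radon_Nikodym_SigmaFinite (abs_cont a) measurableT.
by apply: filterS => y /= h /h; rewrite /density /likelihood_ratio => ->.
Qed.

Let measurable_likelihood a : measurable_fun setT (likelihood_ratio P a).
Proof.
have [_ /(_ a)[_]] := goodP.
by rewrite sqintP => -[].
Qed.

Lemma sqint_density a : sqint P0 (density a).
Proof.
split; first exact: measurable_density.
have [_ /(_ a)[_]] := goodP; rewrite sqintP => -[mL /integrableP[m2 i2]].
apply/integrableP; split.
  by apply/measurable_EFinP; apply: measurable_funX; exact: measurable_density.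
apply: le_lt_trans i2; rewrite le_eqVlt; apply/orP; left; apply/eqP.
apply: ae_eq_integral => //.
- apply/measurable_EFinP; apply: measurableT_comp => //.
  by apply: measurable_funX; exact: measurable_density.
- by apply: measurableT_comp.
- by have := ae_density a; apply: filterS => y /= h /h ->.
Qed.

Lemma Rintegral_density a : \int[P0]_y density a y = 1.
Proof.
rewrite /Rintegral; have := integral_law a (measurable_cst 1%E) (fun=> lee01).
under [RHS]eq_integral do rewrite mul1e.
move=> <-; rewrite integral_cst// mul1e.
exact: (congr1 fine (probability_setT (law P a))).
Qed.

Definition centered a y := density a y - 1.

Lemma sqint_centered a : sqint P0 (centered a).
Proof. exact: sqintD (sqint_density a) (sqint_cst _ (- 1)). Qed.

Lemma Rintegral_centered a : \int[P0]_y centered a y = 0.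
Proof.
rewrite RintegralB//.
- rewrite Rintegral_density Rintegral_cst//= [Z in fine Z](_ : _ = 1%E) ?mulr1 ?subrr//.
  exact: probability_setT.
- exact: sqint_integrable (sqint_density a).
- exact: sqint_integrable (sqint_cst _ 1).
Qed.

Lemma overlapE a b : overlap P a b = inprod P0 (centered a) (centered b).
Proof.
rewrite /overlap /inprod /Rintegral; congr fine.
have mm (g h : Omega -> R) : measurable_fun setT g -> measurable_fun setT h ->
    measurable_fun setT (fun y => ((g y - 1) * (h y - 1))%:E : \bar R).
  by move=> mg mh; apply/measurable_EFinP; apply: measurable_funM; apply: measurable_funB.
apply: ae_eq_integral => //; try by apply: mm => //; exact: measurable_density.
have := ae_density b; have := ae_density a.
by apply: filterS2 => y /= ha hb _; rewrite /centered ha// hb.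
Qed.

Lemma overlapC a b : overlap P a b = overlap P b a.
Proof. by rewrite !overlapE inprodC. Qed.

(** As an integral against the kernel [P], the overlap is measurable in one of the
    letters. *)
Lemma overlap_integral a b :
  (overlap P a b)%:E = (\int[law P b]_y (density a y)%:E - 1%:E)%E.
Proof.
rewrite integral_law; last 2 first.
- by apply/measurable_EFinP; exact: measurable_density.
- by move=> y; rewrite lee_fin density_ge0.
have iab := sqintM (sqint_density a) (sqint_density b).
have -> : overlap P a b = \int[P0]_y (density a y * density b y) - 1.
  rewrite overlapE /inprod.
  transitivity (\int[P0]_y (density a y * density b y - density a y
       - centered b y)).
    by apply: eq_Rintegral => y _; rewrite /centered; ring.
  have ia := sqint_integrable (sqint_density a).
  have ib := sqint_integrable (sqint_centered b).
  have iab' : (P0 : measure Omega R).-integrable setT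
      (EFin \o (fun y => density a y * density b y - density a y)).
    exact: (integrableB measurableT iab ia).
  rewrite RintegralB// RintegralB// Rintegral_centered Rintegral_density; ring.
rewrite EFinB; congr (_ - _)%E.
by rewrite /Rintegral fineK//; exact: integrable_fin_num.
Qed.

(** In [overlap_integral] the law of [letter0] is the reference law, against which
    densities have integral [1]. *)
Lemma overlap_letter0 a : overlap P a (letter0 S) = 0.
Proof.
apply: EFin_inj; rewrite overlap_integral.
rewrite (_ : (\int[_]_y _)%E = 1%E) ?subee//.
transitivity (\int[P0]_y (density a y)%:E)%E; first by [].
rewrite -[LHS]fineK -/(\int[P0]_y density a y) ?Rintegral_density//.
exact: (integrable_fin_num measurableT (sqint_integrable (sqint_density a))).
Qed.

End Density.

Lemma measurable_countable_sections d1 d2 d3 (T1 : measurableType d1)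
    (T2 : measurableType d2) (T3 : measurableType d3)
    (phi : T1 -> nat) (g : nat -> T2 -> T3) :
  (forall k, measurable (phi @^-1` [set k])) ->
  (forall k, measurable_fun setT (g k)) ->
  measurable_fun setT (fun z : T1 * T2 => g (phi z.1) z.2).
Proof.
move=> mphi mg _ B mB; rewrite setTI.
have -> : (fun z : T1 * T2 => g (phi z.1) z.2) @^-1` B =
    \bigcup_k ((phi @^-1` [set k]) `*` (g k @^-1` B)).
  apply/seteqP; split => [[x y] /= gB|[x y] /= [k _ [/= <-]]]//.
  by exists (phi x).
apply: bigcupT_measurable => k; apply: measurableX => //.
by rewrite -[X in measurable X]setTI; exact: mg.
Qed.

Section Clip.
Context d (Omega : measurableType d) (R : realType) (S : alphabet R).
Variable P : R.-pker letter S ~> Omega.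
Variable A : R.
Hypothesis goodP : good_channel P.
Hypothesis A0 : 0 < A.
Hypothesis cont_overlap : forall s t : R, `|s| <= A -> `|t| <= A ->
  {for (s, t), continuous (overlapR P)}.
Implicit Types a b : letter S.

(** The prior is almost surely supported where [clip] is the identity; clipping
    makes overlaps bounded and measurable on all letters. *)
Definition clip a : letter S := if `|a : R| <= A then a else letter0 S.

Local Notation clipR a := (letter_val (clip a)).

Lemma clip_le a : `|clipR a| <= A.
Proof.
by rewrite /clip; case: ifP => // _; rewrite /letter0 /letter_val /= normr0 ltW.
Qed.

Lemma measurable_letter_val : measurable_fun setT (@letter_val R S).
Proof. by move=> _ B mB; rewrite setTI; exists B => //; rewrite setTI. Qed.

Lemma measurable_clip : measurable_fun setT clip.
Proof.
apply: measurable_fun_ifT => //.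
apply: measurable_fun_ler => //.
by apply: measurableT_comp => //; exact: measurable_letter_val.
Qed.

Lemma to_letterK a : to_letter S a = a.
Proof. exact: valKd. Qed.

Definition clipped_overlap (z : letter S * letter S) : R := overlap P (clip z.1) (clip z.2).

Lemma clipped_overlapE z : clipped_overlap z = overlapR P (clipR z.1, clipR z.2).
Proof. by rewrite /clipped_overlap /overlapR /= !to_letterK. Qed.

Lemma clipped_overlap_sym a b : clipped_overlap (a, b) = clipped_overlap (b, a).
Proof. exact: overlapC. Qed.

Lemma measurable_overlap_clip a :
  measurable_fun setT (fun b => overlap P a (clip b)).
Proof.
apply/measurable_EFinP.
apply: (@eq_measurable_fun _ _ _ _ setT
  (fun b => \int[law P (clip b)]_y (density P a y)%:E - 1%:E)%E).
  by move=> b _; rewrite /= overlap_integral.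
apply: emeasurable_funB => //.
apply: (@measurable_fun_integral_kernel _ _ _ _ R (fun b => law P (clip b))).
- move=> U mU; apply: (measurableT_comp (measurable_kernel P U mU)).
  exact: measurable_clip.
- by move=> y; rewrite lee_fin density_ge0.
- by apply/measurable_EFinP; exact: measurable_density.
Qed.

(** The overlap is measurable in the second variable and continuous in the first
    one; it is the limit of the functions obtained by rounding the first variable
    to a grid, which are measurable on each of countably many strips. *)
Lemma measurable_clipped_overlap : measurable_fun setT clipped_overlap.
Proof.
(* [c n (phi n a)] rounds [clip a] down to a grid of mesh [n.+1%:R^-1] based at [- A] *)
pose phi n a := Num.trunc ((clipR a + A) * n.+1%:R).
pose c n k : R := k%:R / n.+1%:R - A.
have cA0 a : 0 <= clipR a + A.
  by have := clip_le a; rewrite ler_norml; lra.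
have cn0 a n : 0 <= (clipR a + A) * n.+1%:R by rewrite mulr_ge0.
apply: (@measurable_fun_cvg _ _ _ _
  (fun n z => overlap P (to_letter S (c n (phi n z.1))) (clip z.2))).
  move=> n.
  apply: (@measurable_countable_sections _ _ _ _ _ _ (phi n)
    (fun k b => overlap P (to_letter S (c n k)) (clip b))); last first.
    by move=> k; exact: measurable_overlap_clip.
  move=> k.
  have mf : measurable_fun setT (fun a => (clipR a + A) * n.+1%:R).
    apply: measurable_funM => //; apply: measurable_funD => //.
    apply: (measurableT_comp measurable_letter_val); exact: measurable_clip.
  have -> : phi n @^-1` [set k] =
     setT `&` (fun a => (clipR a + A) * n.+1%:R) @^-1` `[k%:R, k.+1%:R[.
    rewrite setTI; apply/seteqP; split => a /=; rewrite in_itv /=.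
      by move=> <-; exact: truncn_itv.
    by move=> h; apply/eqP; rewrite truncn_eq.
  exact: mf.
move=> [a b] _ /=; rewrite clipped_overlapE /=.
have key n : (c n (phi n a) <= clipR a <= c n (phi n a) + n.+1%:R^-1).
  have := truncn_itv (cn0 a n); rewrite -/(phi n a) => /andP[h1 h2].
  have n0 : 0 < n.+1%:R :> R by [].
  have e : clipR a + A = ((clipR a + A) * n.+1%:R) / n.+1%:R by field; rewrite nat1r.
  have h1' : (phi n a)%:R / n.+1%:R <= clipR a + A.
    by rewrite ler_pdivrMr.
  have h2' : clipR a + A <= (phi n a)%:R / n.+1%:R + n.+1%:R^-1.
    rewrite -[X in _ <= _ + X]mul1r -mulrDl ler_pdivlMr// natr1; exact: ltW.
  rewrite /c; move: h1' h2'; set u : R := _%:R / _; set w : R := _^-1.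
  by move=> h1' h2'; apply/andP; split; lra.
have cvg_c : c n (phi n a) @[n --> \oo] --> clipR a.
  apply/cvgrPdist_le => e e0.
  have /cvgrPdist_le/(_ _ e0) := @cvg_harmonic R.
  apply: filterS => n; rewrite sub0r normrN => hn.
  have := key n; move: hn; rewrite /harmonic /= ger0_norm// => hn /andP[k1 k2].
  rewrite ler_norml; move: hn k1 k2; set u : R := c n _.
  set w : R := letter_val _; set v : R := _^-1 => hn k1 k2.
  by apply/andP; split; lra.
have cvg_p : (c n (phi n a), clipR b) @[n --> \oo] --> (clipR a, clipR b).
  apply: (@cvg_pair _ _ _ \oo (nbhs (clipR a)) (nbhs (clipR b)) _ _ _ _
    (fun=> clipR b) cvg_c); exact: cvg_cst.
have := cvg_comp _ _ cvg_p (cont_overlap (clip_le a) (clip_le b)).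
apply: cvg_trans; apply: near_eq_cvg; near=> n.
by rewrite /= /overlapR /= to_letterK.
Unshelve. all: by end_near.
Qed.

End Clip.

(** * Orthogonal expansion of the likelihood *)
Section Chaos.
Context d (Omega : measurableType d) (R : realType) (S : alphabet R).
Variable P : R.-pker letter S ~> Omega.
Variable A : R.
Hypothesis goodP : good_channel P.
Variable N : nat.

Local Notation P0 := (channel0 P).
Local Notation Q := (null_law P N).
Local Notation clip := (clip A).
Implicit Types (x : N.-tuple (letter S)) (y : N.-tuple Omega) (T : {set 'I_N}).

Definition factor T x (i : 'I_N) : Omega -> R :=
  if i \in T then centered P (clip (tnth x i)) else fun=> 1.

(** The term of index [T] in the expansion of the likelihood ratio of [x].  The
    product runs over all coordinates, with factor [1] outside [T], to fit the
    integrals of products over [tuple_law]. *)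
Definition chaos T x y : R := \prod_i factor T x i (tnth y i).

Lemma sqint_factor T x i : sqint P0 (factor T x i).
Proof.
by rewrite /factor; case: ifP => _; [exact: sqint_centered|exact: sqint_cst].
Qed.

Lemma Rintegral_factor T x i :
  \int[P0]_y factor T x i y = if i \in T then 0 else 1.
Proof.
rewrite /factor; case: ifP => _; first exact: Rintegral_centered.
rewrite Rintegral_cst// [Z in fine Z](_ : _ = 1%E) ?mulr1//.
exact: probability_setT.
Qed.

Lemma sqint_chaos T x : sqint Q (chaos T x).
Proof.
split.
  by apply: measurable_tuple_prod => i; have [] := sqint_factor T x i.
have := @integrable_tuple_prod _ _ R N (fun=> P0) (fun i u => factor T x i u ^+ 2).
rewrite (_ : (fun y => _) = EFin \o (fun y => chaos T x y ^+ 2)).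
  by apply => i; have [] := sqint_factor T x i.
by apply/funext => y /=; rewrite /chaos prodrXl.
Qed.

Lemma inprod_factor T T' x x' i :
  inprod P0 (factor T x i) (factor T' x' i) =
  if i \in T then (if i \in T' then clipped_overlap P A (tnth x i, tnth x' i) else 0)
  else (if i \in T' then 0 else 1).
Proof.
have [iT|iT] := boolP (i \in T); have [iT'|iT'] := boolP (i \in T').
- by rewrite /clipped_overlap overlapE// /factor iT iT'.
- have := Rintegral_factor T x i; rewrite iT => <-.
  by apply: eq_Rintegral => y _; rewrite [X in _ * X]/factor (negbTE iT') mulr1.
- have := Rintegral_factor T' x' i; rewrite iT' => <-.
  by apply: eq_Rintegral => y _; rewrite [X in X * _]/factor (negbTE iT) mul1r.
- have := Rintegral_factor T x i; rewrite (negbTE iT) => <-.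
  by apply: eq_Rintegral => y _; rewrite [X in _ * X]/factor (negbTE iT') mulr1.
Qed.

(** The factors are independent, and centered exactly at the coordinates in the
    index set; a coordinate in one index set only contributes a zero factor. *)
Lemma inprod_chaos T T' x x' :
  inprod Q (chaos T x) (chaos T' x') =
  if T == T' then \prod_(i in T) clipped_overlap P A (tnth x i, tnth x' i) else 0.
Proof.
have -> : inprod Q (chaos T x) (chaos T' x') =
    \prod_i inprod P0 (factor T x i) (factor T' x' i).
  rewrite /inprod /Rintegral.
  have := @integral_tuple_prod _ _ R N (fun=> P0)
     (fun i u => factor T x i u * factor T' x' i u).
  move=> /(_ (fun i => sqintM (sqint_factor T x i) (sqint_factor T' x' i))).
  move=> /(congr1 fine) /= <-; congr fine; apply: eq_integral => y _.
  by rewrite /chaos big_split.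
under eq_bigr do rewrite inprod_factor.
case: eqVneq => [->|/eqP TT'].
  rewrite [RHS]big_mkcond /=; apply: eq_bigr => i _; by case: (i \in T').
have /existsP[i iTT'] : [exists i, (i \in T) != (i \in T')].
  apply: contrapT => /negP; rewrite negb_exists => /forallP h.
  by apply: TT'; apply/setP => i; have := h i; rewrite negbK => /eqP.
rewrite (bigD1 i)//= (_ : (if _ then _ else _) = 0) ?mul0r//.
by move: iTT'; case: (i \in T); case: (i \in T').
Qed.

(** The likelihood ratio of [x] projected on coordinate degree at most [D]; for
    [D = N] it is the whole ratio (see [prod_density]). *)
Definition low_degree D x y : R := \sum_(T : {set 'I_N} | (#|T| <= D)%N) chaos T x y.

Lemma sqint_low_degree D x : sqint Q (low_degree D x).
Proof. by apply: sqint_sum => T _; exact: sqint_chaos. Qed.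

Definition overlap_sum D (z : N.-tuple (letter S) * N.-tuple (letter S)) : R :=
  elem_sum D (fun i => clipped_overlap P A (tnth z.1 i, tnth z.2 i)).

Lemma inprod_low_degree D x x' : inprod Q (low_degree D x) (low_degree D x') = overlap_sum D (x, x').
Proof.
rewrite /low_degree inprod_suml; [|by move=> T _; exact: sqint_chaos|exact: sqint_low_degree].
apply: eq_bigr => T TD.
rewrite inprod_sumr; [|by move=> T' _; exact: sqint_chaos|exact: sqint_chaos].
rewrite (bigD1 T)//= inprod_chaos eqxx [X in _ + X]big1 ?addr0// => T' /andP[_ T'T].
by rewrite inprod_chaos eq_sym (negbTE T'T).
Qed.

Lemma prod_density x y :
  \prod_i density P (clip (tnth x i)) (tnth y i) = low_degree N x y.
Proof.
transitivity (\sum_(T : {set 'I_N}) chaos T x y); last first.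
  apply: eq_bigl => T; rewrite -[X in (_ <= X)%N](card_ord N).
  by rewrite max_card.
transitivity (\prod_i (centered P (clip (tnth x i)) (tnth y i) + 1)).
  by apply: eq_bigr => i _; rewrite /centered subrK.
rewrite bigA_distr; apply: eq_bigr => T _; apply: eq_bigr => i _.
by rewrite /factor; case: ifP.
Qed.

(** Averaging over a coordinate of [T'] outside [T] leaves [g] fixed and kills the
    centered factor. *)
Lemma inprod_coordinate_chaos T T' (g : N.-tuple Omega -> R) x :
  coordinate_space P T g -> ~~ (T' \subset T) -> inprod Q g (chaos T' x) = 0.
Proof.
move=> [/sqintP gQ gT] /subsetPn[i iT' iT].
rewrite /inprod /Rintegral.
rewrite (@integral_tuple_coord_eq0 _ _ R N (fun=> P0) i
  (fun y => (g y * chaos T' x y)%:E))//.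
  exact: sqintM gQ (sqint_chaos T' x).
move=> y.
pose rest := \prod_(j < N | j != i) factor T' x j (tnth y j).
have E w : (g (tuple_upd i w y) * chaos T' x (tuple_upd i w y))%:E =
    ((g y * rest)%:E * (factor T' x i w)%:E)%E.
  rewrite -EFinM; congr EFin; rewrite (gT _ y); last first.
    by move=> j jT; rewrite tnth_mktuple; case: eqP => // ji; rewrite -ji jT in iT.
  rewrite -mulrA; congr (_ * _); rewrite /chaos (bigD1 i)//= tnth_mktuple eqxx mulrC.
  congr (_ * _); apply: eq_bigr => j ji; by rewrite tnth_mktuple (negbTE ji).
under eq_integral do rewrite E.
have iF := sqint_integrable (sqint_factor T' x i).
rewrite integralZl//.
have := Rintegral_factor T' x i; rewrite iT' /Rintegral => F0.
rewrite -[X in (_ * X)%E]fineK ?F0 ?mule0//.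
exact: (integrable_fin_num measurableT iF).
Qed.

Lemma coordinate_degree_space_sqint D f :
  coordinate_degree_space P D f -> sqint Q f.
Proof.
move=> [g gV fE]; rewrite (_ : f = fun y => \sum_(T : {set 'I_N} | (#|T| <= D)%N) g T y).
  by apply: sqint_sum => T _; apply/sqintP; have [] := gV T.
by apply/funext => y; rewrite fE.
Qed.

(** An index set with more than [D] elements is contained in none of the sets
    on which the summands of [f] depend. *)
Lemma inprod_degree_low_degree D f x : coordinate_degree_space P D f ->
  inprod Q f (low_degree N x) = inprod Q f (low_degree D x).
Proof.
move=> [g gV fE].
have gs T : sqint Q (g T) by apply/sqintP; have [] := gV T.
have -> : f = fun y => \sum_(T : {set 'I_N} | (#|T| <= D)%N) g T y.
  by apply/funext => y; rewrite fE.
rewrite !inprod_suml//; [|exact: sqint_low_degree..].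
apply: eq_bigr => T TD.
rewrite !inprod_sumr//; [|by move=> *; exact: sqint_chaos..].
rewrite [LHS]big_mkcond [RHS]big_mkcond; apply: eq_bigr => T' _.
rewrite (_ : (#|T'| <= N)%N); last by rewrite -[X in (_ <= X)%N](card_ord N) max_card.
case: ifP => // /negbT; rewrite -ltnNge => DT'.
apply: inprod_coordinate_chaos (gV T) _.
by apply/negP => /subset_leq_card; lia.
Qed.

Lemma low_degree_combination D (c : R) (s : seq (N.-tuple (letter S))) :
  coordinate_degree_space P D (fun y => c * \sum_(x <- s) low_degree D x y).
Proof.
exists (fun T y => c * \sum_(x <- s) chaos T x y) => [T|y].
  split.
    apply/sqintP; apply: sqintZ; apply: sqint_sum => x _; exact: sqint_chaos.
  move=> y y' yy'; congr (_ * _); apply: eq_bigr => x _.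
  apply: eq_bigr => i _; rewrite /factor; case: ifP => // iT.
  by rewrite yy'.
by rewrite -mulr_sumr exchange_big.
Qed.

End Chaos.

(** * Expectations under the planted law *)
Section PlantedExpectation.
Context d (Omega : measurableType d) (R : realType) (S : alphabet R).
Variable P : R.-pker letter S ~> Omega.
Variables (A Mr : R).
Hypothesis goodP : good_channel P.
Hypothesis moverlap : measurable_fun setT (clipped_overlap P A).
Hypothesis overlap_le : forall z, `|clipped_overlap P A z| <= Mr.
Variable N : nat.

Local Notation Q := (null_law P N).
Local Notation clip := (clip A).
Local Notation ovs := (overlap_sum P A).
Implicit Types (x : N.-tuple (letter S)) (y : N.-tuple Omega) (T : {set 'I_N}).

Lemma measurable_overlap_sum D :
  measurable_fun setT (ovs D : N.-tuple (letter S) * N.-tuple (letter S) -> R).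
Proof.
rewrite /overlap_sum /elem_sum.
under eq_fun do rewrite big_mkcond.
apply: measurable_sum => T; case: (#|T| <= D)%N; last exact: measurable_cst.
under eq_fun do rewrite big_mkcond.
apply: measurable_prod => i _; case: (i \in T); last exact: measurable_cst.
apply: (measurableT_comp moverlap).
apply: measurable_fun_pair.
  by apply: (measurableT_comp (measurable_tnth i)); exact: measurable_fst.
by apply: (measurableT_comp (measurable_tnth i)); exact: measurable_snd.
Qed.

Definition overlap_sum_bound : R := \sum_(T : {set 'I_N}) \prod_(i in T) Mr.

Lemma overlap_sum_le D (z : N.-tuple (letter S) * N.-tuple (letter S)) : `|ovs D z| <= overlap_sum_bound.
Proof.
have Mr0 : 0 <= Mr by apply: le_trans (overlap_le (letter0 S, letter0 S)).
apply: (le_trans (ler_norm_sum _ _ _)); rewrite big_mkcond; apply: ler_sum => T _.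
case: ifP => _; last by rewrite prodr_ge0.
by rewrite normr_prod; apply: ler_prod => i _; rewrite normr_ge0 overlap_le.
Qed.

Lemma overlap_sum_sym D x x' : ovs D (x, x') = ovs D (x', x).
Proof.
apply: eq_bigr => T _; apply: eq_bigr => i _; exact: clipped_overlap_sym.
Qed.

Definition clipped_law x : probability (N.-tuple Omega) R :=
  tuple_law (fun i => law P (clip (tnth x i))).

Lemma measurable_clipped_law (B : set (N.-tuple Omega)) : measurable B ->
  measurable_fun setT (fun x => clipped_law x B : \bar R).
Proof.
move=> mB.
pose clipT x := [tuple clip (tnth x i) | i < N].
have mclipT : measurable_fun setT clipT.
  apply/measurable_fun_tnthP => i.
  rewrite (_ : _ \o _ = clip \o (fun x => tnth x i)).
    by apply: (measurableT_comp (measurable_clip A)); exact: measurable_tnth.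
  by apply/funext => x /=; rewrite tnth_mktuple.
apply: (@eq_measurable_fun _ _ _ _ setT
  (fun x => tuple_law (fun i => law P (tnth (clipT x) i)) B : \bar R)).
  move=> x _; rewrite /clipped_law.
  congr ((tuple_law _ : probability _ _) B).
  by apply/funext => i; rewrite tnth_mktuple.
exact: (measurableT_comp (measurable_tuple_law P mB) mclipT).
Qed.

(** The mean of [f] given the signal [x]; see [integral_clipped_law]. *)
Definition planted_mean (f : N.-tuple Omega -> R) x : R := inprod Q f (low_degree P A N x).

(** The likelihood ratio of the clipped law is the full expansion. *)
Lemma integral_clipped_law (h : N.-tuple Omega -> R) x :
  sqint Q h -> (forall y, 0 <= h y) ->
  (\int[clipped_law x]_y (h y)%:E = (planted_mean h x)%:E)%E.
Proof.
move=> hQ h0.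
rewrite (@ge0_integral_tuple_density _ _ R N (fun=> channel0 P) _
  (fun i => density P (clip (tnth x i))))//.
- rewrite /planted_mean /inprod /Rintegral fineK; last first.
    apply: integrable_fin_num => //.
    exact: (sqintM hQ (sqint_low_degree A goodP N x)).
  by apply: eq_integral => y _; rewrite -EFinM (prod_density P A).
- by move=> i; exact: measurable_density.
- by move=> i y; exact: density_ge0.
- by move=> i f mf f0; exact: integral_law.
- by apply/measurable_EFinP; case: hQ.
Qed.

Lemma measurable_planted_mean_ge0 (h : N.-tuple Omega -> R) :
  sqint Q h -> (forall y, 0 <= h y) -> measurable_fun setT (planted_mean h).
Proof.
move=> hQ h0; apply/measurable_EFinP.
apply: (@eq_measurable_fun _ _ _ _ setT
  (fun x => \int[clipped_law x]_y (h y)%:E)%E).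
  by move=> x _; rewrite integral_clipped_law.
apply: (@measurable_fun_integral_kernel _ _ _ _ R clipped_law).
- exact: measurable_clipped_law.
- by move=> y; rewrite lee_fin.
- by apply/measurable_EFinP; case: hQ.
Qed.

Lemma planted_mean_le (f : N.-tuple Omega -> R) x : sqint Q f -> inprod Q f f <= 1 ->
  `|planted_mean f x| <= 1 + overlap_sum_bound.
Proof.
move=> fQ f1.
have := cauchy_schwarz fQ (sqint_low_degree A goodP N x) f1.
rewrite inprod_low_degree// -/(planted_mean f x) -(real_normK (num_real (planted_mean _ _))).
have := le_trans (ler_norm _) (overlap_sum_le N (x, x)).
have := sqr_ge0 (`|planted_mean f x| - 1).
by rewrite sqrrB; nra.
Qed.

Lemma planted_meanB (f g : N.-tuple Omega -> R) x : sqint Q f -> sqint Q g ->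
  planted_mean (fun y => f y - g y) x = planted_mean f x - planted_mean g x.
Proof.
move=> fQ gQ; have PQ := sqint_low_degree A goodP N x.
rewrite /planted_mean /inprod -RintegralB//.
- by apply: eq_Rintegral => y _; rewrite mulrBl.
- exact: sqintM fQ PQ.
- exact: sqintM gQ PQ.
Qed.

Definition pospart (f : N.-tuple Omega -> R) y : R := Num.max (f y) 0.

Lemma pospart_ge0 f y : 0 <= pospart f y.
Proof. by rewrite /pospart le_max lexx orbT. Qed.

Lemma pospart_sub f y : f y = pospart f y - pospart (fun y => - f y) y.
Proof.
rewrite /pospart; have [f0|f0] := boolP (0 <= f y).
  by rewrite max_l// max_r ?subr0 ?oppr_le0.
move: f0; rewrite -ltNge => /ltW f0.
by rewrite max_r // max_l ?opprK ?add0r// oppr_ge0.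
Qed.

Lemma pospart_sqr_le f y : pospart f y ^+ 2 <= f y ^+ 2.
Proof.
rewrite /pospart; have [f0|f0] := boolP (0 <= f y); first by rewrite max_l.
move: f0; rewrite -ltNge => /ltW f0.
by rewrite max_r // expr0n sqr_ge0.
Qed.

Lemma sqint_pospart f : sqint Q f -> sqint Q (pospart f).
Proof.
move=> [mf f2].
have mp : measurable_fun setT (pospart f) by exact: measurable_maxr.
split => //; apply: (integrable_le _ f2); first exact: measurable_funX.
by move=> y; rewrite ger0_norm ?sqr_ge0 ?pospart_sqr_le.
Qed.

Lemma inprod_pospart_le f : sqint Q f -> inprod Q (pospart f) (pospart f) <= inprod Q f f.
Proof.
move=> fQ; apply: le_Rintegral => //.
- exact: sqintM (sqint_pospart fQ) (sqint_pospart fQ).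
- exact: sqintM.
- by move=> y _; rewrite -!expr2 pospart_sqr_le.
Qed.

Lemma sqintN f : sqint Q f -> sqint Q (fun y => - f y).
Proof. by move=> /(sqintZ (-1)); under eq_fun do rewrite mulN1r. Qed.

Lemma inprodNN f : inprod Q (fun y => - f y) (fun y => - f y) = inprod Q f f.
Proof. by apply: eq_Rintegral => y _; rewrite mulrNN. Qed.

Lemma measurable_planted_mean f : sqint Q f -> measurable_fun setT (planted_mean f).
Proof.
move=> fQ.
have p1 := sqint_pospart fQ; have p2 := sqint_pospart (sqintN fQ).
apply: (@eq_measurable_fun _ _ _ _ setT (fun x => planted_mean (pospart f) x -
   planted_mean (pospart (fun y => - f y)) x)).
  move=> x _; rewrite /= -planted_meanB//; congr (inprod _ _ _).
  by apply/funext => y; rewrite -pospart_sub.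
by apply: measurable_funB; apply: measurable_planted_mean_ge0 => // y; exact: pospart_ge0.
Qed.

Variable X : probability (N.-tuple (letter S)) R.
Hypothesis XA : {ae X, forall x, norm_infty x <= A}.

Lemma integral_planted (h : N.-tuple Omega -> \bar R) :
  measurable_fun setT h -> (forall y, 0 <= h y)%E ->
  (\int[planted_law P X]_y h y =
   \int[X]_x \int[tuple_law (fun i => law P (tnth x i))]_y h y)%E.
Proof.
move=> mh h0.
pose k x : giry (N.-tuple Omega) R := tuple_law (fun i => law P (tnth x i)).
have mk : measurable_fun setT k.
  apply: measurable_giry_codensity => // B mB; exact: measurable_tuple_law.
have <- : (\int[giry_bind X mk]_y h y = \int[X]_x \int[k x]_y h y)%E.
  exact: giry_int_bind.
apply: eq_measure_integral => B mB _.
have := @giry_int_bind _ _ _ _ R X k mk (EFin \o \1_B) _ _.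
rewrite /giry_int integral_indic// setIT => -> //; last 2 first.
- by apply/measurable_EFinP; exact: measurable_indic.
- by move=> y; rewrite lee_fin.
by apply: eq_integral => x _; rewrite integral_indic// setIT.
Qed.

Lemma integral_planted_clipped (h : N.-tuple Omega -> R) :
  sqint Q h -> (forall y, 0 <= h y) ->
  (\int[planted_law P X]_y (h y)%:E = \int[X]_x (planted_mean h x)%:E)%E.
Proof.
move=> hQ h0; have mh : measurable_fun setT (EFin \o h).
  by apply/measurable_EFinP; case: hQ.
rewrite integral_planted//.
under [RHS]eq_integral do rewrite -integral_clipped_law//.
have mint (l : N.-tuple (letter S) -> probability (N.-tuple Omega) R) :
   (forall B, measurable B -> measurable_fun setT (fun x => l x B : \bar R)) ->
   measurable_fun setT (fun x => \int[l x]_y (h y)%:E)%E.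
  move=> ml; apply: (@measurable_fun_integral_kernel _ _ _ _ R l) => //.
apply: ge0_ae_eq_integral => //.
- by apply: mint => B mB; exact: measurable_tuple_law.
- by apply: mint; exact: measurable_clipped_law.
- by move=> x _; apply: integral_ge0 => y _; rewrite lee_fin.
- by move=> x _; apply: integral_ge0 => y _; rewrite lee_fin.
apply: filterS XA => x xA _.
have -> // : clipped_law x = tuple_law (fun i => law P (tnth x i)).
rewrite /clipped_law; congr tuple_law; apply/funext => i; congr law.
rewrite /clip (_ : `|_| <= A)//; apply: le_trans xA; exact: le_bigmax_cond.
Qed.

Lemma planted_mean_integrable f : sqint Q f -> inprod Q f f <= 1 ->
  X.-integrable setT (EFin \o planted_mean f).
Proof.
move=> fQ f1; apply: (bounded_integrable X (measurable_planted_mean fQ)).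
by move=> x; exact: planted_mean_le.
Qed.

(** The positive and negative parts of [f] have bounded conditional means, so [f] is
    integrable under the planted law. *)
Lemma expectation_planted f : sqint Q f -> inprod Q f f <= 1 ->
  ('E_(planted_law P X)[f] = (\int[X]_x planted_mean f x)%:E)%E.
Proof.
move=> fQ f1.
have p1 := sqint_pospart fQ; have p2 := sqint_pospart (sqintN fQ).
have n1 := le_trans (inprod_pospart_le fQ) f1.
have n2 : inprod Q (pospart (fun y => - f y)) (pospart (fun y => - f y)) <= 1.
  by apply: le_trans (inprod_pospart_le (sqintN fQ)) _; rewrite inprodNN.
have i1 := planted_mean_integrable p1 n1; have i2 := planted_mean_integrable p2 n2.
have E g : sqint Q (pospart g) -> X.-integrable setT (EFin \o planted_mean (pospart g)) ->
   (\int[planted_law P X]_y (pospart g y)%:E =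
     (\int[X]_x planted_mean (pospart g) x)%:E)%E.
  move=> gQ gi; rewrite integral_planted_clipped//; last by move=> y; exact: pospart_ge0.
  by rewrite /Rintegral fineK//; exact: (integrable_fin_num measurableT gi).
have I g : sqint Q (pospart g) -> X.-integrable setT (EFin \o planted_mean (pospart g)) ->
   (planted_law P X).-integrable setT (EFin \o pospart g).
  move=> gQ gi; apply/integrableP; split; first by apply/measurable_EFinP; case: gQ.
  under eq_integral do rewrite /= ger0_norm ?pospart_ge0//.
  by rewrite E// ltry.
rewrite unlock.
transitivity (\int[planted_law P X]_y ((pospart f y)%:E -
    (pospart (fun y => - f y) y)%:E))%E.
  by apply: eq_integral => y _; rewrite -EFinB -pospart_sub.
rewrite integralB_EFin//; [|exact: I..].
rewrite !E// -EFinB -RintegralB//; congr EFin.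
apply: eq_Rintegral => x _; rewrite -planted_meanB//; congr (inprod _ _ _).
by apply/funext => y; rewrite -pospart_sub.
Qed.

End PlantedExpectation.

(** * The advantage as a mean overlap *)
Section AdvantageFormula.
Context d (Omega : measurableType d) (R : realType) (S : alphabet R).
Variable P : R.-pker letter S ~> Omega.
Variables (A Mr : R).
Hypothesis goodP : good_channel P.
Hypothesis moverlap : measurable_fun setT (clipped_overlap P A).
Hypothesis overlap_le : forall z, `|clipped_overlap P A z| <= Mr.
Variables (N : nat) (X : probability (N.-tuple (letter S)) R).
Hypothesis XA : {ae X, forall x, norm_infty x <= A}.
Variable D : nat.

Local Notation Q := (null_law P N).
Local Notation K := (overlap_sum P A D : N.-tuple (letter S) * N.-tuple (letter S) -> R).
Local Notation M := (overlap_sum_bound Mr N).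
Local Notation kappa := (kernel_total X K).
Local Notation V := (@coordinate_degree_space _ Omega R S P N D).
Implicit Types (x : N.-tuple (letter S)) (f : N.-tuple Omega -> R).

(** Divide by [n ^ 2] and let [n] grow. *)
Lemma le0_of_quadratic (a b : R) :
  (forall n : nat, 0 <= n%:R ^+ 2 * a + n%:R * b) -> 0 <= a.
Proof.
move=> h; rewrite leNgt; apply/negP => a0.
have := h (Num.bound (`|b| / - a)).+1; set n := _.+1.
have n0 : 0 < n%:R :> R by [].
rewrite expr2 -mulrA -mulrDr pmulr_rge0// leNgt => /negP; apply.
have : `|b| / - a < n%:R.
  apply: lt_le_trans (archi_boundP _) _; last by rewrite ler_nat.
  by rewrite divr_ge0// oppr_ge0 ltW.
rewrite ltr_pdivrMr ?oppr_gt0//; have := ler_norm b; lra.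
Qed.

Let mK : measurable_fun setT K.
Proof. exact: measurable_overlap_sum. Qed.

Let K_le z : `|K z| <= M.
Proof. exact: overlap_sum_le. Qed.

Let K_sym x x' : K (x, x') = K (x', x).
Proof. exact: overlap_sum_sym. Qed.
Let pm_int f : sqint Q f -> inprod Q f f <= 1 ->
  X.-integrable setT (EFin \o planted_mean P A f).
Proof. by move=> fQ f1; exact: (planted_mean_integrable goodP overlap_le). Qed.

Let gram_sumE s : gram_sum K s =
  inprod Q (fun y => \sum_(x <- s) low_degree P A D x y) (fun y => \sum_(x <- s) low_degree P A D x y).
Proof.
have sP x : sqint Q (low_degree P A D x) by exact: sqint_low_degree.
rewrite inprod_suml//; last exact: sqint_sum.
apply: eq_bigr => x _; rewrite inprod_sumr//.
by apply: eq_bigr => x' _; rewrite inprod_low_degree.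
Qed.

(** Cauchy-Schwarz makes [K(x, x') - phi(x) phi(x')] a positive semidefinite kernel,
    where [phi] is the conditional mean of [f]; its Gram sums being nonnegative,
    [exists_gram_sum_le] on large samples makes its integral nonnegative. *)
Lemma planted_mean_sqr_le f : V f -> inprod Q f f <= 1 ->
  (\int[X]_x planted_mean P A f x) ^+ 2 <= kappa.
Proof.
move=> fV f1; have fQ := coordinate_degree_space_sqint fV.
set phi := planted_mean P A f; set e := \int[X]_x phi x.
have mphi : measurable_fun setT phi by exact: measurable_planted_mean.
have phi_le x : `|phi x| <= 1 + M by exact: planted_mean_le.
have iphi : X.-integrable setT (EFin \o phi) by exact: pm_int.
pose H (z : N.-tuple (letter S) * N.-tuple (letter S)) := K z - phi z.1 * phi z.2.
have mH : measurable_fun setT H.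
  apply: measurable_funB => //; apply: measurable_funM.
    by apply: (measurableT_comp mphi); exact: measurable_fst.
  by apply: (measurableT_comp mphi); exact: measurable_snd.
have HM z : `|H z| <= M + (1 + M) * (1 + M).
  apply: (le_trans (ler_normB _ _)); apply: lerD; first exact: K_le.
  by rewrite normrM ler_pM.
have Hsym x x' : H (x, x') = H (x', x) by rewrite /H /= K_sym mulrC.
have HT : kernel_total X H = kappa - e ^+ 2.
  have Hm y : kernel_mean X H y = kernel_mean X K y - e * phi y.
    rewrite /kernel_mean /H /= RintegralB//; last 2 first.
    - apply: (@bounded_integrable _ _ _ _ _ M) => [|x]; last exact: K_le.
      exact: measurable_kernel_section.
    - apply: (@bounded_integrable _ _ _ _ _ ((1 + M) * (1 + M))) => [|x].
        exact: measurable_funM.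
      by rewrite normrM ler_pM.
    by rewrite RintegralZr.
  rewrite /kernel_total; under eq_Rintegral do rewrite Hm.
  rewrite RintegralB//; last 2 first.
  - exact: bounded_integrable (measurable_kernel_mean X mK K_le) (kernel_mean_le X mK K_le).
  - exact: integrableZR.
  by rewrite RintegralZl// expr2.
rewrite -subr_ge0 -HT.
apply: (@le0_of_quadratic _ (2 * (M + (1 + M) * (1 + M)))) => n.
have [s _ hs] := exists_gram_sum_le X mH HM Hsym n.
rewrite mulrA [_ * 2]mulrC; apply: le_trans hs.
have -> : gram_sum H s = gram_sum K s - (\sum_(x <- s) phi x) ^+ 2.
  rewrite /gram_sum expr2 mulr_suml -sumrB; apply: eq_bigr => x _.
  by rewrite mulr_sumr -sumrB.
rewrite subr_ge0 gram_sumE.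
have sP x : sqint Q (low_degree P A D x) by exact: sqint_low_degree.
have -> : \sum_(x <- s) phi x = inprod Q f (fun y => \sum_(x <- s) low_degree P A D x y).
  rewrite inprod_sumr//; apply: eq_bigr => x _.
  by rewrite /phi /planted_mean (inprod_degree_low_degree A goodP x fV).
by apply: cauchy_schwarz => //; exact: sqint_sum.
Qed.

(** Apply [exists_gram_sum_le] to [K(x, x') - k(x) - k(x')], where [k] is the mean
    of [K] in one variable: up to normalization the Gram sum is then the squared
    distance of the sample average of [low_degree] to its mean, less [kappa].  So for a large
    sample, the normalized average is almost optimal. *)
Lemma kernel_total_le_sqr (C : R) : 0 <= C ->
  (forall f, V f -> inprod Q f f <= 1 -> \int[X]_x planted_mean P A f x <= C) ->
  kappa <= C ^+ 2.
Proof.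
move=> C0 hC.
have [k kE] : exists k, k = kernel_mean X K by exists (kernel_mean X K).
have mk : measurable_fun setT k by rewrite kE; exact: measurable_kernel_mean mK K_le.
have k_le x : `|k x| <= M by rewrite kE; exact: kernel_mean_le mK K_le x.
have ik := bounded_integrable X mk k_le.
have iK y : X.-integrable setT (EFin \o (fun x => K (x, y))).
  apply: (@bounded_integrable _ _ _ _ _ M) => [|x]; last exact: K_le.
  exact: measurable_kernel_section.
pose H (z : N.-tuple (letter S) * N.-tuple (letter S)) := K z - k z.1 - k z.2.
have mH : measurable_fun setT H.
  have m1 : measurable_fun setT
      (fun z : N.-tuple (letter S) * N.-tuple (letter S) => k z.1).
    by apply: (measurableT_comp mk); exact: measurable_fst.
  have m2 : measurable_fun setT
      (fun z : N.-tuple (letter S) * N.-tuple (letter S) => k z.2).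
    by apply: (measurableT_comp mk); exact: measurable_snd.
  exact: measurable_funB (measurable_funB mK m1) m2.
have HM z : `|H z| <= M + M + M.
  apply: (le_trans (ler_normB _ _)); apply: lerD => //.
  by apply: (le_trans (ler_normB _ _)); apply: lerD => //; exact: K_le.
have Hsym x x' : H (x, x') = H (x', x) by rewrite /H K_sym; exact: addrAC.
have icst c : X.-integrable setT (EFin \o (fun=> c)).
  exact: sqint_integrable (sqint_cst X c).
have cstE c : \int[X]_x c = c.
  rewrite Rintegral_cst// [Z in fine Z](_ : _ = 1%E) ?mulr1//.
  exact: probability_setT.
have HT : kernel_total X H = - kappa.
  have Hm y : kernel_mean X H y = - kappa.
    rewrite /kernel_mean /H /= RintegralB//; last first.
      exact: (integrableB measurableT (iK y) ik).
    rewrite RintegralB//; rewrite cstE -/(kernel_mean X K y) -kE.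
    by rewrite /kernel_total -kE addrAC subrr add0r.
  by rewrite /kernel_total; under eq_Rintegral do rewrite Hm; rewrite cstE.
rewrite -subr_ge0; apply: (@le0_of_quadratic _ (2 * (M + M + M) + 1)) => n.
have [s ss hs] := exists_gram_sum_le X mH HM Hsym n.
pose a := \sum_(y <- s) k y; set b := gram_sum K s.
have sP x : sqint Q (low_degree P A D x) by exact: sqint_low_degree.
have sPs : sqint Q (fun y => \sum_(x <- s) low_degree P A D x y) by exact: sqint_sum.
have HE : gram_sum H s = b - 2 * n%:R * a.
  have e1 : \sum_(x <- s) \sum_(y <- s) k y = n%:R * a.
    by rewrite big_const_seq count_predT iter_addr_0 ss mulr_natl.
  have e2 : \sum_(x <- s) \sum_(y <- s) k x = n%:R * a.
    rewrite /a mulr_sumr; apply: eq_bigr => x _.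
    by rewrite big_const_seq count_predT iter_addr_0 ss mulr_natl.
  rewrite /gram_sum /H /=.
  under eq_bigr do rewrite !sumrB.
  by rewrite !sumrB e1 e2 /b /gram_sum; ring.
have b0 : 0 <= b by rewrite /b gram_sumE; exact: inprod_ge0.
(* the added [1] avoids dividing by a vanishing norm *)
pose r := Num.sqrt (b + 1).
have r0 : 0 < r by rewrite sqrtr_gt0; lra.
have r2 : r ^+ 2 = b + 1 by rewrite sqr_sqrtr//; lra.
have aC : a <= C * r.
  rewrite mulrC -ler_pdivrMl//.
  pose f y := r^-1 * \sum_(x <- s) low_degree P A D x y.
  have fV : V f by exact: low_degree_combination.
  have f1 : inprod Q f f <= 1.
    rewrite /f inprodZl//; last exact: sqintZ.
    rewrite inprodC inprodZl// -gram_sumE -/b mulrA -invfM -expr2 r2.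
    by rewrite mulrC ler_pdivrMr; lra.
  apply: le_trans (hC f fV f1).
  have -> : \int[X]_x planted_mean P A f x = \int[X]_x (r^-1 * \sum_(y <- s) K (x, y)).
    apply: eq_Rintegral => x _.
    rewrite /planted_mean (inprod_degree_low_degree A goodP x fV) /f inprodZl//.
    rewrite inprod_suml//; congr (_ * _); apply: eq_bigr => y _.
    by rewrite inprod_low_degree// K_sym.
  have isum (u : seq (N.-tuple (letter S))) :
      X.-integrable setT (EFin \o (fun x => \sum_(y <- u) K (x, y))).
    elim: u => [|y u IH]; first by under eq_fun do rewrite big_nil; exact: icst.
    by under eq_fun do rewrite big_cons; exact: integrableDR.
  rewrite RintegralZl//.
  apply: ler_wpM2l; first by rewrite invr_ge0 ltW.
  rewrite /a kE; elim: (s) => [|y u IH].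
    by rewrite big_nil; under eq_Rintegral do rewrite big_nil; rewrite cstE lexx.
  rewrite big_cons; under eq_Rintegral do rewrite big_cons.
  by rewrite RintegralD// ?lerD//; exact: isum.
move: hs; rewrite HE HT => hs.
have n0 : 0 <= n%:R :> R by [].
have h1 : 2 * n%:R * a <= 2 * n%:R * (C * r).
  by rewrite ler_wpM2l// mulr_ge0.
have h2 := sqr_ge0 (n%:R * C - r); rewrite sqrrB exprMn r2 in h2.
case: n ss hs {HE} n0 h1 h2 => [|n] ss hs n0 h1 h2; first by rewrite expr0n !mul0r addr0.
have n1 : 1 <= n.+1%:R :> R by rewrite ler1n.
lra.
Qed.

Theorem CAdv_sqr : (CAdv P X D ^+ 2 = kappa%:E)%E.
Proof.
have sq f : inprod Q f f = \int[Q]_y (f y ^+ 2).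
  by apply: eq_Rintegral => y _; rewrite expr2.
have normE f : sqint Q f -> ('E_Q[(fun y => f y ^+ 2)%R] = (inprod Q f f)%:E)%E.
  move=> [_ f2]; rewrite unlock sq /Rintegral fineK//.
  exact: (integrable_fin_num measurableT f2).
have V0 : V (fun=> 0).
  have -> : (fun=> 0) = (fun y => 0 * \sum_(x <- [::]) low_degree P A D x y)
      :> (N.-tuple Omega -> R) by apply/funext => y; rewrite mul0r.
  exact: low_degree_combination.
have Q0 : inprod Q (fun=> 0) (fun=> 0) = 0 :> R.
  rewrite /inprod; under eq_Rintegral do rewrite mul0r.
  by rewrite Rintegral_cst// mul0r.
have kappa0 : 0 <= kappa.
  by apply: le_trans (planted_mean_sqr_le V0 _); rewrite ?sqr_ge0// Q0.
have upper f : V f -> inprod Q f f <= 1 ->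
    \int[X]_x planted_mean P A f x <= Num.sqrt kappa.
  move=> fV f1; rewrite (le_trans (ler_norm _))// -sqrtr_sqr ler_wsqrtr//.
  exact: planted_mean_sqr_le.
have EP f : V f -> inprod Q f f <= 1 ->
    ('E_(planted_law P X)[f] = (\int[X]_x planted_mean P A f x)%:E)%E.
  move=> fV f1; apply: (expectation_planted goodP overlap_le XA) => //.
  exact: coordinate_degree_space_sqint fV.
have Cle : (CAdv P X D <= (Num.sqrt kappa)%:E)%E.
  apply: ub_ereal_sup => _ [f [fV fE] <-].
  have fQ := coordinate_degree_space_sqint fV.
  by rewrite normE// lee_fin in fE; rewrite EP// lee_fin upper.
have geC f : V f -> inprod Q f f <= 1 ->
    ((\int[X]_x planted_mean P A f x)%:E <= CAdv P X D)%E.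
  move=> fV f1; apply: ereal_sup_ubound; exists f; last by rewrite EP.
  by split => //; rewrite normE ?lee_fin//; exact: coordinate_degree_space_sqint fV.
have C0 : (0 <= CAdv P X D)%E.
  apply: le_trans (geC _ V0 _); last by rewrite Q0.
  rewrite lee_fin; apply: Rintegral_ge0 => x _; rewrite /planted_mean /inprod.
  by under eq_Rintegral do rewrite mul0r; rewrite Rintegral_cst// mul0r.
move: Cle geC C0; case: (CAdv P X D) => [c|//|//]; rewrite lee_fin => Cle geC.
rewrite lee_fin => c0.
rewrite -EFin_expe; congr EFin; apply/eqP; rewrite eq_le; apply/andP; split.
  by rewrite -(sqr_sqrtr kappa0) lerXn2r// nnegrE ?sqrtr_ge0.
by apply: kernel_total_le_sqr => // f fV f1; have := geC f fV f1; rewrite lee_fin.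
Qed.

End AdvantageFormula.

(** * Comparison with the truncated exponential of the inner product *)
Section AlmostEverywhere.
Context d (T : measurableType d) (R : realType) (X : probability T R).

Lemma ae_product (G : T -> Prop) : {ae X, forall x, G x} ->
  {ae (X \x X)%E, forall z, G z.1 /\ G z.2}.
Proof.
move=> [B [mB B0 GB]].
exists ((B `*` setT) `|` (setT `*` B)); split.
- by apply: measurableU; exact: measurableX.
- apply/eqP; rewrite eq_le measure_ge0 andbT.
  apply: (@le_trans _ _ ((X \x X) (B `*` setT) + (X \x X) (setT `*` B))%E).
    by apply: measureU2; exact: measurableX.
  rewrite !product_measure1E//.
  have -> : (X B * X setT)%E = 0%E by rewrite B0 mul0e.
  have -> : (X setT * X B)%E = 0%E by rewrite B0 mule0.
  by rewrite adde0.
- move=> [x y] /= /not_andP[]/= h; [left|right]; split => //=; exact: GB.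
Qed.

Lemma ae_bounded_integrable (g : T * T -> R) (c : R) : measurable_fun setT g ->
  {ae (X \x X)%E, forall z, `|g z| <= c} ->
  (X \x X)%E.-integrable setT (EFin \o g).
Proof.
move=> mg gc; apply/integrableP; split; first exact/measurable_EFinP.
apply: (@le_lt_trans _ _ (\int[(X \x X)%E]_z `|c|%:E)%E).
  apply: ae_ge0_le_integral => //.
  - by apply: measurableT_comp => //; exact/measurable_EFinP.
  - apply: filterS gc => z gz _ /=; rewrite lee_fin; exact: le_trans (ler_norm _).
by rewrite integral_cst//= product_setT mule1 ltry.
Qed.

Lemma ae_le_Rintegral (f g : T * T -> R) :
  (X \x X)%E.-integrable setT (EFin \o f) -> (X \x X)%E.-integrable setT (EFin \o g) ->
  {ae (X \x X)%E, forall z, f z <= g z} ->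
  \int[(X \x X)%E]_z f z <= \int[(X \x X)%E]_z g z.
Proof.
move=> fi gi fg; rewrite -subr_ge0 -RintegralB//.
have mfg : measurable_fun setT (fun z => g z - f z).
  apply: measurable_funB; apply/measurable_EFinP; [exact: measurable_int gi|exact: measurable_int fi].
rewrite /Rintegral (ae_eq_integral (fun z => (Num.max (g z - f z) 0)%:E))//.
- by apply: fine_ge0; apply: integral_ge0 => z _; rewrite lee_fin le_max lexx orbT.
- exact/measurable_EFinP.
- by apply/measurable_EFinP; apply: measurable_maxr.
- by apply: filterS fg => z fgz _; rewrite max_l// subr_ge0.
Qed.

End AlmostEverywhere.

Section Universality.
Context d (Omega : measurableType d) (R : realType) (S : alphabet R).
Variable P : R.-pker letter S ~> Omega.
Variables (A B2 B4 B6 : R).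
Hypotheses (A0 : 0 < A) (B20 : 0 < B2) (B40 : 0 < B4) (B60 : 0 < B6).
Hypotheses (goodP : good_channel P) (C1P : assumption_C1 P A) (C2P : assumption_C2 P).

Local Notation F := (fisher_information P).

Lemma to_letter0 : to_letter S 0 = letter0 S.
Proof. exact: (to_letterK (letter0 S)). Qed.

Lemma overlapR_approx : exists2 M : R, 0 <= M &
  forall a b, `|a| <= A -> `|b| <= A ->
    `|overlapR P (a, b) - F * (a * b)| <= M * (`|a| * `|b| * (a ^+ 2 + b ^+ 2)).
Proof.
have [U [_ AU _ C4]] := C1P.
apply: (bilinear_approx A0 AU C4) => //.
- by move=> a b _ _; exact: overlapC.
- by move=> a _; rewrite /overlapR /= to_letter0 overlap_letter0.
Qed.

Let cont_overlap (s t : R) : `|s| <= A -> `|t| <= A ->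
  {for (s, t), continuous (overlapR P)}.
Proof.
have [U [_ AU _ [C0 _]]] := C1P.
by move=> sA tA; apply: C0; apply: AU; split; rewrite /= in_itv /= -ler_norml.
Qed.

Lemma clipped_overlap_bounded : exists Mr : R, forall z, `|clipped_overlap P A z| <= Mr.
Proof.
have [U [_ AU _ [C0 _]]] := C1P.
have [M _ hM] := bounded_on_box A0 AU C0.
by exists M => z; rewrite clipped_overlapE; apply: hM; exact: clip_le.
Qed.

Let moverlap : measurable_fun setT (clipped_overlap P A).
Proof. exact: measurable_clipped_overlap. Qed.

Definition univ_integrand N (D : int) (z : N.-tuple (letter S) * N.-tuple (letter S)) : R :=
  exp_trunc D (F * inner z.1 z.2).

Lemma measurable_univ_integrand N D : measurable_fun setT (@univ_integrand N D).
Proof.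
have mi : measurable_fun setT
    (fun z : N.-tuple (letter S) * N.-tuple (letter S) => F * inner z.1 z.2).
  apply: measurable_funM => //; apply: measurable_sum => i.
  apply: measurable_funM; apply: (measurableT_comp (@measurable_letter_val R S)).
    by apply: (measurableT_comp (measurable_tnth i)); exact: measurable_fst.
  by apply: (measurableT_comp (measurable_tnth i)); exact: measurable_snd.
case: D => n; rewrite /univ_integrand /exp_trunc; last exact: measurable_cst.
by apply: measurable_sum => i; apply: measurable_funM => //; exact: measurable_funX.
Qed.

Lemma exp_trunc_norm_le (D : int) (t : R) : `|exp_trunc D t| <= expR `|t|.
Proof.
case: D => n /=; last by rewrite normr0 expR_ge0.
apply: le_trans (texp_le_expR n (normr_ge0 t)).
apply: (le_trans (ler_norm_sum _ _ _)); apply: ler_sum => i _.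
by rewrite normrM normrX normfV [`|_`!%:R|]ger0_norm.
Qed.

Section FixedPrior.
Variables (N : nat) (X : probability (N.-tuple (letter S)) R).
Hypotheses (N0 : (0 < N)%N).
Hypotheses (P1 : assumption_P1 X A) (P2 : assumption_P2 X B2 B4 B6).

Lemma ae_tame : {ae (X \x X)%E, forall z, tame A B2 B4 B6 z.1 /\ tame A B2 B4 B6 z.2}.
Proof.
apply: ae_product; have [h2 h4 h6] := P2.
near=> x; split.
- by near: x; exact: P1.
- by near: x; exact: h2.
- by near: x; exact: h4.
- by near: x; exact: h6.
Unshelve. all: by end_near.
Qed.

Lemma inner_tame_le (x x' : N.-tuple (letter S)) : tame A B2 B4 B6 x -> tame A B2 B4 B6 x' ->
  `|inner x x'| <= N%:R * (A * A).
Proof.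
move=> [xA _ _ _] [x'A _ _ _].
apply: (le_trans (ler_norm_sum _ _ _)).
have -> : N%:R * (A * A) = \sum_(i < N) A * A.
  by rewrite sumr_const card_ord mulr_natl.
by apply: ler_sum => i _; rewrite normrM ler_pM// norm_infty_le.
Qed.

Lemma univ_integrable D : (X \x X)%E.-integrable setT (EFin \o @univ_integrand N D).
Proof.
apply: (@ae_bounded_integrable _ _ _ _ _ (expR (`|F| * (N%:R * (A * A))))).
  exact: measurable_univ_integrand.
apply: filterS ae_tame => z [t1 t2]; apply: (le_trans (exp_trunc_norm_le _ _)).
by rewrite ler_expR normrM ler_wpM2l// inner_tame_le.
Qed.

Lemma UnivE D : Univ X F^-1 D = (\int[(X \x X)%E]_z univ_integrand D z)%:E.
Proof.
rewrite /Univ /Rintegral fineK; last exact: integrable_fin_num (univ_integrable D).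
by apply: eq_integral => z _; rewrite invrK.
Qed.

Lemma CAdv_sqr_integral D : (CAdv P X D ^+ 2 =
  (\int[(X \x X)%E]_z overlap_sum P A D z)%:E)%E /\
  (X \x X)%E.-integrable setT
    (EFin \o (overlap_sum P A D : N.-tuple (letter S) * N.-tuple (letter S) -> R)).
Proof.
have [Mr hMr] := clipped_overlap_bounded.
set K := (overlap_sum P A D : N.-tuple (letter S) * N.-tuple (letter S) -> R).
have mK : measurable_fun setT K by exact: measurable_overlap_sum.
have K_le : forall z, `|K z| <= overlap_sum_bound Mr N by exact: overlap_sum_le.
have iK := kernel_integrable X mK K_le.
split=> //; rewrite (CAdv_sqr goodP moverlap hMr P1).
have K_sym x x' : K (x, x') = K (x', x) by exact: overlap_sum_sym.
congr EFin; rewrite /kernel_total [RHS]/Rintegral -(integral12_prod_meas1 iK).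
rewrite /Rintegral; congr fine; apply: eq_integral => x _.
rewrite (kernel_meanE X mK K_le).
by apply: eq_integral => x' _ /=; rewrite K_sym.
Qed.

Lemma overlap_sum_tame D (x x' : N.-tuple (letter S)) :
  tame A B2 B4 B6 x -> tame A B2 B4 B6 x' ->
  overlap_sum P A D (x, x') =
  elem_sum D (fun i => overlapR P (tnth x i : R, tnth x' i : R)).
Proof.
move=> [xA _ _ _] [x'A _ _ _].
apply: eq_bigr => T _; apply: eq_bigr => i _; rewrite clipped_overlapE /=.
by rewrite /clip !norm_infty_le.
Qed.

End FixedPrior.

(** Both sides are integrals over pairs of draws, and the pointwise comparison of
    [elem_sum_texp_bounds] holds almost everywhere. *)
Lemma universality : exists2 C : R, 0 < C &
  forall (N : nat) (X : probability (N.-tuple (letter S)) R),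
    (0 < N)%N -> assumption_P1 X A -> assumption_P2 X B2 B4 B6 ->
    forall D : nat, ~~ odd D ->
      (CAdv P X D ^+ 2 <= C%:E * Univ X F^-1 D%:Z)%E /\
      (2^-1%:E * Univ X F^-1 D%:Z - C%:E * Univ X F^-1 (D%:Z - 2)%R
        <= CAdv P X D ^+ 2)%E.
Proof.
have [M M0 hM] := overlapR_approx.
have [C C0 hC] := elem_sum_texp_bounds (M * (B6 ^+ 6 + B2 ^+ 2))
  (2 * F ^+ 2 * B4 ^+ 4 + 2 * (M * (B6 ^+ 6 + B2 ^+ 2)) ^+ 2).
exists C => // N X N0 P1 P2 D eD.
have [-> iK] := CAdv_sqr_integral P1 D.
rewrite !UnivE// -!EFinM -EFinB !lee_fin.
have iU n := univ_integrable P1 P2 n.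
have key : {ae (X \x X)%E, forall z,
   overlap_sum P A D z <= C * univ_integrand D z /\
   2^-1 * univ_integrand D z - C * univ_integrand (D%:Z - 2) z <= overlap_sum P A D z}.
  apply: filterS (ae_tame P1 P2) => -[x x'] [t1 t2].
  have [r1 r2] := overlap_moments B20 B40 B60 M0 N0 hM t1 t2.
  by rewrite overlap_sum_tame//; exact: hC.
split.
  rewrite -RintegralZl//; apply: ae_le_Rintegral => //.
    exact: (integrableZl measurableT C (iU D)).
  by apply: filterS key => z [].
have i1 := integrableZl measurableT 2^-1 (iU D).
have i2 := integrableZl measurableT C (iU (D%:Z - 2)).
rewrite -!RintegralZl// -RintegralB//; apply: ae_le_Rintegral => //.
  exact: (integrableB measurableT i1 i2).
by apply: filterS key => z [].
Qed.

End Universality.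

Theorem theorem3p9 (R : realType) (d : measure_display)
    (Omega : measurableType d) (S : alphabet R)
    (P : R.-pker letter S ~> Omega) (A B2 B4 B6 : R) :
  0 < A -> 0 < B2 -> 0 < B4 -> 0 < B6 ->
  good_channel P -> assumption_C1 P A -> assumption_C2 P ->
  (exists2 C1 : R, 0 < C1 &
    forall (N : nat) (X : probability (N.-tuple (letter S)) R),
      (0 < N)%N -> assumption_P1 X A -> assumption_P2 X B2 B4 B6 ->
      forall D : nat, ~~ odd D ->
        (CAdv P X D ^+ 2 <=
         C1%:E * Univ X (fisher_information P)^-1 D%:Z)%E) /\
  (forall B8 B10 B12 : R, 0 < B8 -> 0 < B10 -> 0 < B12 ->
    exists C2 C3 : R, [/\ 0 < C2, 0 < C3 &
      forall (N : nat) (X : probability (N.-tuple (letter S)) R),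
        (0 < N)%N -> assumption_P1 X A -> assumption_P2 X B2 B4 B6 ->
        assumption_P3 X B8 B10 B12 ->
        forall D : nat, ~~ odd D ->
          (C2%:E * Univ X (fisher_information P)^-1 D%:Z
             - C3%:E * Univ X (fisher_information P)^-1 (D%:Z - 2)%R
           <= CAdv P X D ^+ 2)%E]).
Proof.
move=> A0 B20 B40 B60 goodP C1P C2P.
have [C C0 hC] := universality A0 B20 B40 B60 goodP C1P C2P.
split; first by exists C => // N X N0 P1 P2 D eD; have [] := hC N X N0 P1 P2 D eD.
move=> B8 B10 B12 _ _ _; exists 2^-1, C; split=> // N X N0 P1 P2 _ D eD.
by have [] := hC N X N0 P1 P2 D eD.
Qed.
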